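(* Let $f_1,\dots,f_4\in L^2(\mathbb{R}_+)$ be non-zero real-valued functions with $\langle f_i,f_j\rangle_{L^2(\mathbb{R}_+)}=0$ for $i\ne j$. Set $f=f_1\wedge f_2\wedge f_3\wedge f_4\in\Lambda_4$, $F=J_4(f)$, and, with $q=4$, $$K(F)=m(F^4)-2m(F^2)^2-\frac{(-1)^q}{2}(2q)!\int_0^\infty\|f(t,\cdot)\wedge f\|^2_{L^2(\mathbb{R}_+^{2q-1})}\,dt .$$ Then 1. $K(F)\ne0$; 2. $\|f\,\hat\wedge_2\,f\|_{L^2(\mathbb{R}_+^4)}=0$.
   Context: $L^2(\mathbb{R}_+)$ is the complex $L^2$ space for Lebesgue measure (inner products linear in the second variable), with complex conjugation $J$. For $h\in L^2(\mathbb{R}_+^n)$ its anti-symmetrization is $\hat h(t_1,\dots,t_n)=\frac1{n!}\sum_{\sigma\in S_n}\mathrm{sgn}(\sigma)h(t_{\sigma(1)},\dots,t_{\sigma(n)})$. $\Lambda_n$ is the space of anti-symmetric functions in $L^2(\mathbb{R}_+^n)$ with inner product $\langle f,g\rangle_{\Lambda_n}=n!\int\overline{f}g\,d\mathbf{x}$, and $\Lambda_0=\mathbb{C}$. For $f\in\Lambda_p$, $g\in\Lambda_q$, $f\wedge g$ is the anti-symmetrization of $f\otimes g$, and $f_1\wedge\dots\wedge f_n$ is the anti-symmetrization of $f_1\otimes\dots\otimes f_n$. $\Gamma_a=\bigoplus_{n\ge0}\Lambda_n$ is the anti-symmetric Fock space (Hilbert direct sum) with vacuum vector $\Omega=1\in\Lambda_0$.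 For $z\in L^2(\mathbb{R}_+)$, $b^*(z)$ is the bounded operator with $b^*(z)w=z\wedge w$ for $w\in\Lambda_n$, $b(z)$ is its adjoint, and $\Psi(z)=b^*(z)+b(Jz)$. $\mathcal{C}$ is the von Neumann algebra generated by $\{\Psi(z)\}$, and $m(u)=\langle\Omega,u\Omega\rangle$ is a faithful normal tracial state on it; $L^2(\mathcal{C})$ is the completion of $\mathcal{C}$ for the inner product $m(u^*v)$. The map $u\mapsto u\Omega$ extends to a unitary $L^2(\mathcal{C})\to\Gamma_a$, and for $f\in\Lambda_n$, $J_n(f)\in L^2(\mathcal{C})$ denotes the element mapped to $f$ by this unitary. $f\hat\wedge_2f$ is the anti-symmetrization of $(f\wedge_2f)(t_1,\dots,t_4)=\int_{\mathbb{R}_+^2}f(t_1,t_2,s_2,s_1)f(s_1,s_2,t_3,t_4)\,ds_1ds_2$. *)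

(* Defs.v *)
From HB Require Import structures.
From mathcomp Require Import all_boot all_order all_algebra perm ring_quotient.
From mathcomp Require Import complex.
From mathcomp Require Import all_classical all_reals all_analysis.
From mathcomp Require Import measurable_realfun ring lra.

Set Implicit Arguments.
Unset Strict Implicit.
Unset Printing Implicit Defensive.
Import Order.TTheory GRing.Theory Num.Theory.
Import numFieldNormedType.Exports.

Local Open Scope classical_set_scope.
Local Open Scope complex_scope.
Local Open Scope ring_scope.

Section half_line.
Context {R : realType}.
Local Notation rT := (measurableTypeR R).

(* L^2(R_+) is L^2 of the whole line for Lebesgue measure restricted to
   [0, +oo[: values at negative reals are invisible up to a.e. equality. *)
Definition muR := mrestr (@lebesgue_measure R)
  (measurable_itv `[0, +oo[%R : measurable (`[0, +oo[%classic : set rT)).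
HB.instance Definition _ := Measure.on muR.

Lemma muR_sigma_finite : sigma_finite [set: rT] muR.
Proof.
have [F UF Foo] := sigma_finiteT (@lebesgue_measure R).
exists F => // k; have [mF Fk] := Foo k; split=> //.
apply: le_lt_trans Fk; rewrite /muR /mrestr.
apply: le_measure; rewrite ?inE; [|exact: mF|exact: subIsetl].
by apply: measurableI; [exact: mF|exact: measurable_itv].
Qed.
HB.instance Definition _ :=
  @Measure_isSigmaFinite.Build _ _ _ muR muR_sigma_finite.

Definition consR n (p : rT * n.-tuple rT) : n.+1.-tuple rT :=
  [tuple of p.1 :: p.2].

Lemma measurable_consR n : measurable_fun setT (@consR n).
Proof. exact: measurable_cons. Qed.

(* The library has no product measure on n.-tuple; consR identifies
   R * R^n with R^(n+1). *)
Definition cons_measure n (m : {sigma_finite_measure set (n.-tuple rT) -> \bar R})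
  := pushforward (muR \x m)%E (@consR n).

Section cons_measure.
Variables (n : nat) (m : {sigma_finite_measure set (n.-tuple rT) -> \bar R}).
Local Notation cm := (cons_measure m).

Let cons_measure0 : cm set0 = 0%E.
Proof. by rewrite /cons_measure /pushforward preimage_set0 measure0. Qed.

Let cons_measure_ge0 A : (0 <= cm A)%E.
Proof. exact: (measure_ge0 (muR \x m)%E). Qed.

Let cons_measure_sigma_additive : semi_sigma_additive cm.
Proof.
exact: (@measure_semi_sigma_additive _ _ _ 
  (measure_function_pushforward__canonical__measure_function_Measure
     (muR \x m)%E (@measurable_consR n))).
Qed.

HB.instance Definition _ := isMeasure.Build _ _ _ cm
  cons_measure0 cons_measure_ge0 cons_measure_sigma_additive.

Let cons_measure_sigma_finite : sigma_finite setT cm.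
Proof.
have /sigma_finiteP[F [TF ndF Foo]] := sigma_finiteT muR.
have /sigma_finiteP[G [TG ndG Goo]] := sigma_finiteT m.
have [H UH Hoo] : sigma_finite setT (muR \x m)%E.
  exists (fun k => F k `*` G k).
    rewrite -setXTT TF TG predeqE => -[x y]; split.
      move=> [/= [i _ Fix] [j _ Gjy]]; exists (maxn i j) => //; split.
      - by move: x Fix; exact/subsetPset/ndF/leq_maxl.
      - by move: y Gjy; exact/subsetPset/ndG/leq_maxr.
    by move=> [k _ []/= ? ?]; split; exists k.
  move=> k; have [? ?] := Foo k; have [? ?] := Goo k.
  split; first exact: measurableX.
  by rewrite product_measure1E// lte_mul_pinfty// ge0_fin_numE.
exists (fun k => [set t : n.+1.-tuple rT | H k (thead t, [tuple of behead t])]).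
  rewrite predeqE => t; split=> // _.
  have : setT (thead t, [tuple of behead t]) by [].
  by rewrite UH => -[k _ Fk]; exists k.
move=> k; have [mF Fk] := Hoo k.
split.
  rewrite -[X in measurable X]setTI.
  have mp : measurable_fun [set: n.+1.-tuple rT]
      (fun t => (thead t, [tuple of behead t])).
    apply/measurable_fun_pairP; split => /=.
      exact: measurable_tnth.
    exact: measurable_behead.
  exact: mp.
rewrite /cons_measure /pushforward.
suff -> : @consR n @^-1`
   [set t : n.+1.-tuple rT | H k (thead t, [tuple of behead t])] = H k by [].
apply/seteqP; split=> -[a b] /=; rewrite /consR theadE /=;
  by have -> : [tuple of behead [tuple of a :: b]] = b by exact/val_inj.
Qed.

HB.instance Definition _ := @Measure_isSigmaFinite.Build _ _ _ cm
  cons_measure_sigma_finite.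
End cons_measure.

Fixpoint muRn n : {sigma_finite_measure set (n.-tuple rT) -> \bar R} :=
  match n with
  | 0 => \d_ [tuple]
  | n.+1 => cons_measure (muRn n)
  end.
End half_line.

Local Notation normc := ComplexField.Normc.normc.

Section complex_L2.
Context d (T : measurableType d) {R : realType}.
Variable m : {measure set T -> \bar R}.
Implicit Types f g : T -> R[i].

Definition cintegral f : R[i] :=
  (\int[m]_x complex.Re (f x)) +i* (\int[m]_x complex.Im (f x)).

Definition L2fun f : Prop :=
  ((fun x => complex.Re (f x)) \in Lfun m 2%:E) /\
  ((fun x => complex.Im (f x)) \in Lfun m 2%:E).

Definition L2ip f g : R[i] := cintegral (fun x => conjc (f x) * g x).

Definition L2norm f : \bar R := Lnorm m 2%:E (fun x => (normc (f x))%:E).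

Lemma L2norm_sqr f :
  (L2norm f ^+ 2 = \int[m]_x ((normc (f x)) ^+ 2)%:E)%E.
Proof.
have sqE (x : \bar R) : (0 <= x -> x ^+ 2 = x `^ 2)%E.
  case: x => [r r0| _|//]; first by rewrite poweR_EFin powR_mulrn// EFin_expe.
  by rewrite poweRyr ?pnatr_eq0// expe2 mulyy.
rewrite sqE ?Lnorm_ge0// poweR_Lnorm//; apply: eq_integral => x _.
have nx0 : 0 <= normc (f x) by case: (f x) => a b; exact: sqrtr_ge0.
by rewrite abse_EFin ger0_norm// poweR_EFin powR_mulrn.
Qed.

Lemma normc_sqr (z : R[i]) : normc z ^+ 2 = complex.Re z ^+ 2 + complex.Im z ^+ 2.
Proof. by case: z => a b /=; rewrite sqr_sqrtr// addr_ge0// sqr_ge0. Qed.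

Lemma L2fun0 : L2fun (fun=> 0).
Proof.
have [F0 _] := Lfun_submod_closed m (lee1n 2 : (1 <= 2%:E :> \bar R)%E).
have E : (fun=> 0 : R) \in Lfun m 2%:E by exact: F0.
by split; exact: E.
Qed.

Lemma L2funP (a : R[i]) f g :
  L2fun f -> L2fun g -> L2fun (fun x => a * f x + g x).
Proof.
have [_ FP] := Lfun_submod_closed m (lee1n 2 : (1 <= 2%:E :> \bar R)%E).
move=> [fr fi] [gr gi].
have E b u v : u \in Lfun m 2%:E -> v \in Lfun m 2%:E ->
   (fun x => b * u x + v x) \in Lfun m 2%:E by exact: FP.
split.
  rewrite [X in X \in _](_ : _ = fun x => complex.Re a * complex.Re (f x) +
      (- complex.Im a * complex.Im (f x) + complex.Re (g x))).
    exact: E fr (E _ _ _ fi gr).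
  apply/funext => x; case: a (f x) (g x) => [? ?] [? ?] [? ?] /=.
  by rewrite mulNr addrA.
rewrite [X in X \in _](_ : _ = fun x => complex.Re a * complex.Im (f x) +
    (complex.Im a * complex.Re (f x) + complex.Im (g x))).
  exact: E fi (E _ _ _ fr gi).
by apply/funext => x; case: a (f x) (g x) => [? ?] [? ?] [? ?] /=; rewrite addrA.
Qed.

Lemma measurable_normc_sqr f : L2fun f ->
  measurable_fun setT (fun x => ((normc (f x)) ^+ 2)%:E).
Proof.
move=> [/andP[/[!inE] mr _] /andP[/[!inE] mi _]].
apply/measurable_EFinP; under eq_fun do rewrite normc_sqr.
by apply: measurable_funD; exact: measurable_funX.
Qed.

Lemma normc_sqrP (a z w : R[i]) :
  normc (a * z + w) ^+ 2 <= 2 * normc a ^+ 2 * normc z ^+ 2 + 2 * normc w ^+ 2.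
Proof.
rewrite !normc_sqr; case: a z w => [a a'] [z z'] [w w'] /=.
have := sqr_ge0 (a * z - a' * z' - w).
have := sqr_ge0 (a * z' + a' * z - w').
lra.
Qed.

Lemma L2norm_sqrP (a : R[i]) f g : L2fun f -> L2fun g ->
  (L2norm (fun x => a * f x + g x)%R ^+ 2 <=
   (2 * normc a ^+ 2)%:E * L2norm f ^+ 2 + 2%:E * L2norm g ^+ 2)%E.
Proof.
move=> Lf Lg; rewrite !L2norm_sqr.
have mf := measurable_normc_sqr Lf.
have mg := measurable_normc_sqr Lg.
have a0 : 0 <= 2 * normc a ^+ 2 by rewrite mulr_ge0 ?sqr_ge0.
rewrite -!ge0_integralZl//; [|by move=> x _; rewrite lee_fin sqr_ge0..].
rewrite -ge0_integralD//; first last.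
- exact: emeasurable_funM.
- by move=> x _; rewrite -EFinM lee_fin mulr_ge0 ?sqr_ge0.
- exact: emeasurable_funM.
- by move=> x _; rewrite -EFinM lee_fin mulr_ge0 ?sqr_ge0.
apply: ge0_le_integral => //.
- by move=> x _; rewrite lee_fin sqr_ge0.
- exact/measurable_normc_sqr/L2funP.
- by apply: emeasurable_funD; exact: emeasurable_funM.
- by move=> x _; rewrite -!EFinM -EFinD lee_fin normc_sqrP.
Qed.
End complex_L2.

Section wedge.
Context {R : realType}.
Local Notation rT := (measurableTypeR R).

Definition permt n (s : 'S_n) (t : n.-tuple rT) : n.-tuple rT :=
  [tuple tnth t (s i) | i < n].

Definition antisym n (h : n.-tuple rT -> R[i]) : n.-tuple rT -> R[i] :=
  fun t => (n`!%:R)^-1 * \sum_(s : 'S_n) (-1) ^+ s * h (permt s t).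

Definition tensor p q (f : p.-tuple rT -> R[i]) (g : q.-tuple rT -> R[i]) :
    (p + q).-tuple rT -> R[i] :=
  fun t => f [tuple tnth t (lshift q i) | i < p]
         * g [tuple tnth t (rshift p i) | i < q].

Definition wedge p q (f : p.-tuple rT -> R[i]) (g : q.-tuple rT -> R[i]) :=
  antisym (tensor f g).

Definition bigwedge n (f : 'I_n -> rT -> R[i]) : n.-tuple rT -> R[i] :=
  antisym (fun t => \prod_(i < n) f i (tnth t i)).

Definition fun1 (z : rT -> R[i]) : 1.-tuple rT -> R[i] :=
  fun t => z (thead t).

(* slice f t = f(t, .) *)
Definition slice n (f : n.+1.-tuple rT -> R[i]) (t : rT) :
    n.-tuple rT -> R[i] :=
  fun s => f [tuple of t :: s].

Definition contract2 (f g : 4.-tuple rT -> R[i]) : 4.-tuple rT -> R[i] :=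
  fun t => cintegral (muRn 2) (fun s : 2.-tuple rT =>
    f [tuple t`_0; t`_1; s`_1; s`_0] * g [tuple s`_0; s`_1; t`_2; t`_3]).

(* Functions antisymmetric at every point, not just almost everywhere: a class
   that is antisymmetric a.e. contains such a function, its
   antisymmetrization. *)
Definition Lambda n (h : n.-tuple rT -> R[i]) : Prop :=
  L2fun (muRn n) h /\
  forall (s : 'S_n) (t : n.-tuple rT), h (permt s t) = (-1) ^+ s * h t.
End wedge.

Section fock.
Context {R : realType}.
Local Notation rT := (measurableTypeR R).
Local Notation C := R[i].

(* A function on seq rT is the same thing as a sequence of functions, the n-th
   one on n.-tuple rT; a prefock is thus a family (h_n)_n of representatives,
   h_n in Lambda_n, with \sum_n n! ||h_n||^2 < +oo. *)
Definition comp (x : seq rT -> C) n (t : n.-tuple rT) : C := x t.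
Arguments comp x n t : clear implicits.

Definition prefock_pred : {pred seq rT -> C} := fun x =>
  `[< (forall n, Lambda (comp x n)) /\
      (\sum_(0 <= n <oo) n`!%:R%:E * L2norm (muRn n) (comp x n) ^+ 2 < +oo)%E >].

Lemma LambdaP n (a : C) (f g : n.-tuple rT -> C) :
  Lambda f -> Lambda g -> Lambda (fun t => a * f t + g t).
Proof.
move=> [Lf Af] [Lg Ag]; split; first exact: L2funP.
by move=> s t; rewrite Af Ag mulrDr mulrCA.
Qed.

Lemma L2norm_sqr_ge0 n (h : n.-tuple rT -> C) :
  (0 <= n`!%:R%:E * L2norm (muRn n) h ^+ 2)%E.
Proof.
rewrite mule_ge0// ?lee_fin ?ler0n// L2norm_sqr.
by apply: integral_ge0 => x _; rewrite lee_fin sqr_ge0.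
Qed.

Lemma prefock_submod : submod_closed prefock_pred.
Proof.
split.
  apply/asboolP; split=> [n|].
    by split=> [|s t]; [exact: L2fun0|rewrite /comp mulr0].
  rewrite eseries0// => n _ _; rewrite L2norm_sqr integral0_eq ?mule0// => t _.
  by rewrite /comp /= expr0n/= addr0 sqrtr0 expr0n.
move=> a x y /asboolP[Lx Sx] /asboolP[Ly Sy]; apply/asboolP; split=> [n|].
  exact: LambdaP.
apply: (@le_lt_trans _ _ (\sum_(0 <= n <oo)
   ((2 * normc a ^+ 2)%:E * (n`!%:R%:E * L2norm (muRn n) (comp x n) ^+ 2) +
   2%:E * (n`!%:R%:E * L2norm (muRn n) (comp y n) ^+ 2)))%E).
  apply: lee_nneseries => [n _ _|n _]; first exact: L2norm_sqr_ge0.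
  rewrite [leRHS](_ : _ = n`!%:R%:E * ((2 * normc a ^+ 2)%:E *
      L2norm (muRn n) (comp x n) ^+ 2 +
      2%:E * L2norm (muRn n) (comp y n) ^+ 2))%E; last first.
    have N0 (h : n.-tuple rT -> C) : (0 <= L2norm (muRn n) h ^+ 2)%E.
      by rewrite L2norm_sqr integral_ge0// => t _; rewrite lee_fin sqr_ge0.
    rewrite ge0_muleDr; [by congr (_ + _)%E; rewrite muleCA| |].
      by apply: mule_ge0 => //; rewrite lee_fin mulr_ge0 ?sqr_ge0.
    exact: mule_ge0.
  apply: lee_wpmul2l; first by rewrite lee_fin ler0n.
  apply: L2norm_sqrP.
  - exact: (Lx n).1.
  - exact: (Ly n).1.
have a0 : 0 <= 2 * normc a ^+ 2 by rewrite mulr_ge0 ?sqr_ge0.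
rewrite nneseriesD; last 2 first.
- by move=> n _ _; rewrite mule_ge0 ?lee_fin// L2norm_sqr_ge0.
- by move=> n _ _; rewrite mule_ge0 ?lee_fin// L2norm_sqr_ge0.
rewrite !nneseriesZl; try by move=> n _; exact: L2norm_sqr_ge0.
by rewrite lte_add_pinfty// lte_mul_pinfty// lee_fin.
Qed.

HB.instance Definition _ :=
  GRing.isSubmodClosed.Build _ _ prefock_pred prefock_submod.

Record prefock := Prefock { prefock_val :> seq rT -> C ;
                            _ : prefock_val \in prefock_pred }.
HB.instance Definition _ := [isSub for prefock_val].
HB.instance Definition _ := [Choice of prefock by <:].
HB.instance Definition _ := [SubChoice_isSubLmodule of prefock by <:].

Lemma compZ (a : C) (x : prefock) n t : comp (a *: x) n t = a * comp x n t.
Proof. by []. Qed.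

Definition prefock_null : {pred prefock} := fun x =>
  `[< forall n, comp x n = (fun=> 0) %[ae muRn n] >].

Lemma prefock_null_zmod : zmod_closed prefock_null.
Proof.
split; first by apply/asboolP => n; exact: aeW.
move=> x y /asboolP x0 /asboolP y0; apply/asboolP => n.
move: (x0 n) (y0 n); apply: filterS2 => t xt yt _.
have -> : comp (x - y) n t = comp x n t - comp y n t by [].
by rewrite xt// yt// subr0.
Qed.

HB.instance Definition _ :=
  GRing.isZmodClosed.Build _ prefock_null prefock_null_zmod.

(* The Fock space: prefock modulo a.e. equality of all the components. *)
Definition fock := Quotient.quot prefock_null.
HB.instance Definition _ := GRing.Zmodule.on fock.
HB.instance Definition _ := EqQuotient.on fock.

Local Open Scope quotient_scope.

Definition fock_scale (a : C) (x : fock) : fock := \pi_fock (a *: repr x).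

Lemma fock_scale_pi a x : fock_scale a (\pi_fock x) = \pi_fock (a *: x).
Proof.
apply/eqP; rewrite -Quotient.idealrBE -scalerBr.
have : repr (\pi_fock x) - x \in prefock_null.
  by rewrite Quotient.idealrBE reprK.
move: (_ - x) => y /asboolP y0; apply/asboolP => n.
move: (y0 n); apply: filterS => t yt _.
have -> : comp (a *: y) n t = a * comp y n t.
  exact: compZ.
by rewrite yt// mulr0.
Qed.

Lemma fock_scaleA a b x : fock_scale a (fock_scale b x) = fock_scale (a * b) x.
Proof. by rewrite -[x]reprK !fock_scale_pi scalerA reprK. Qed.

Lemma fock_scale1 : left_id 1 fock_scale.
Proof. by move=> x; rewrite -[x]reprK fock_scale_pi scale1r. Qed.

Lemma fock_scaleDr : right_distributive fock_scale +%R.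
Proof.
by move=> a x y; rewrite -[x]reprK -[y]reprK -raddfD !fock_scale_pi scalerDr raddfD.
Qed.

Lemma fock_scaleDl x : {morph fock_scale^~ x : a b / a + b}.
Proof.
by move=> a b; rewrite -[x]reprK !fock_scale_pi scalerDl raddfD.
Qed.

HB.instance Definition _ := GRing.Zmodule_isLmodule.Build C fock
  fock_scaleA fock_scale1 fock_scaleDr fock_scaleDl.

(* The factor n! is the one in the inner product of Lambda_n; R[i] carries no
   topology here, so the series is summed by real and imaginary parts. *)
Definition fock_ip (x y : fock) : C :=
  let u n := n`!%:R * L2ip (muRn n) (comp (repr x) n) (comp (repr y) n) in
  limn (series (fun n => complex.Re (u n))) +i*
  limn (series (fun n => complex.Im (u n))).

Definition fock_norm (x : fock) : R := Num.sqrt (complex.Re (fock_ip x x)).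

Definition extend0 n (w : n.-tuple rT -> C) : seq rT -> C :=
  fun s => oapp w 0 (insub s).

Lemma comp_extend0 n (w : n.-tuple rT -> C) : comp (extend0 w) n = w.
Proof. by apply/funext => t; rewrite /comp /extend0 valK. Qed.

Lemma comp_extend0_neq n (w : n.-tuple rT -> C) k : k != n ->
  comp (extend0 w) k = fun=> 0.
Proof.
move=> kn; apply/funext => t; rewrite /comp /extend0 insubF//=.
by rewrite size_tuple; exact: negbTE.
Qed.

Lemma extend0_prefock n (w : n.-tuple rT -> C) :
  Lambda w -> extend0 w \in prefock_pred.
Proof.
move=> [Lw Aw].
have L0 k : k != n -> (L2norm (muRn k) (comp (extend0 w) k) ^+ 2 = 0)%E.
  move=> kn; rewrite comp_extend0_neq// L2norm_sqr integral0_eq// => t _.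
  by rewrite /= expr0n/= addr0 sqrtr0 expr0n.
apply/asboolP; split=> [k|].
  have [->|kn] := eqVneq k n; first by rewrite comp_extend0.
  by rewrite comp_extend0_neq//; split=> [|s t]; [exact: L2fun0|rewrite mulr0].
rewrite (@nneseriesD1 _ _ n)//; last by move=> k _; exact: L2norm_sqr_ge0.
rewrite eseries0 ?adde0; last by move=> k _ kn; rewrite L0 ?mule0.
rewrite comp_extend0 lte_mul_pinfty ?lee_fin// L2norm_sqr.
under eq_integral do rewrite normc_sqr.
have [Lr Li] := Lw.
have /integrableP[_] := integrableD measurableT (Lfun2_integrable_sqr Lr)
  (Lfun2_integrable_sqr Li).
apply: le_lt_trans; rewrite le_eqVlt; apply/orP; left; apply/eqP.
by apply: eq_integral => t _; rewrite /= ger0_norm// addr_ge0 ?sqr_ge0.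
Qed.

(* The inclusion of Lambda_n in the Fock space; insubd makes it 0 outside
   Lambda_n (see extend0_prefock). *)
Definition in_degree n (w : n.-tuple rT -> C) : fock :=
  \pi_fock (insubd 0 (extend0 w)).

Definition vacuum : fock := in_degree (fun _ : 0.-tuple rT => 1).

Lemma Lambda_vacuum : Lambda (fun _ : 0.-tuple rT => 1 : C).
Proof.
split=> [|s t].
  by split; exact: (Lfun_cst (\d_ ([tuple] : 0.-tuple rT))).
by rewrite (_ : s = 1%g) ?odd_perm1 ?mulr1//; apply/permP => -[].
Qed.

Definition is_bounded (T : fock -> fock) : Prop :=
  linear T /\ exists M : R, forall x, fock_norm (T x) <= M * fock_norm x.

(* A bounded B with this property is unique, finite-particle vectors being
   dense; likewise for the adjoint. So z determines B = b^*(z) in is_creation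
   and A = b(z) in is_annihilation. *)
Definition is_creation (z : rT -> C) (B : fock -> fock) : Prop :=
  is_bounded B /\
  forall n (w : n.-tuple rT -> C), Lambda w ->
    Lambda (wedge (fun1 z) w) /\ B (in_degree w) = in_degree (wedge (fun1 z) w).

Definition is_adjoint (A B : fock -> fock) : Prop :=
  forall x y, fock_ip (A x) y = fock_ip x (B y).

Definition is_annihilation (z : rT -> C) (A : fock -> fock) : Prop :=
  is_bounded A /\ exists2 B, is_creation z B & is_adjoint A B.

Definition conjJ (z : rT -> C) : rT -> C := fun t => conjc (z t).

Definition Psi_set : set (fock -> fock) :=
  [set T | exists z B A, [/\ L2fun muR z, is_creation z B,
    is_annihilation (conjJ z) A & T = (fun x => B x + A x)]].

(* Commutant in the algebra of bounded operators. Psi_set is closed under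
   adjoints, as Psi(z)^* = Psi(Jz), so the von Neumann algebra it generates is
   its double commutant. *)
Definition commutant (S : set (fock -> fock)) : set (fock -> fock) :=
  [set T | is_bounded T /\ forall A, S A -> T \o A = A \o T].

Definition CliffordvN : set (fock -> fock) := commutant (commutant Psi_set).

Definition trace_m (u : fock -> fock) : C := fock_ip vacuum (u vacuum).

(* u in C represents J_n(f) in L^2(C): the unitary L^2(C) -> fock maps the class
   of u to u vacuum. Such a u is unique since the trace is faithful. *)
Definition is_chaos n (f : n.-tuple rT -> C) (u : fock -> fock) : Prop :=
  [/\ Lambda f, CliffordvN u & u vacuum = in_degree f].

(* K(F) for F = J_q(f), q = n.+1, where u in C represents F *)
Definition K_fun n (f : n.+1.-tuple rT -> C) (u : fock -> fock) : C :=
  let q := n.+1 in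
  trace_m (iter 4 u) - 2 * trace_m (iter 2 u) ^+ 2
  - (-1) ^+ q / 2 * (2 * q)`!%:R *
    (fine (\int[muR]_t L2norm (muRn (n + q)) (wedge (slice f t) f) ^+ 2)%E)%:C.
End fock.
Arguments fock R : clear implicits.

(* Main.v *)
(* By the Clifford relations Psi(f_1)...Psi(f_4) represents F, since it maps the
   vacuum to f. The operators Phi(w) = b^*(w) - b(Jw) anticommute with every
   Psi(z), so T = Phi(f_1)...Phi(f_4) commutes with the von Neumann algebra; it
   has the same value at the vacuum as F, hence F^k and T^k agree there, and
   T^2 = N with N = prod_i |f_i|^2. Thus m(F^2) = N, m(F^4) = N^2, and
   K(F) = -N^2 - c with c >= 0.

   b(z) is realized as h |-> n int conj(z(t)) h(t, .) dt, whose adjointness to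
   b^*(z) comes from the invariance of the measure under moving one variable to
   the front; the boundedness of both follows from
   |b^*(z) h|^2 + |b(z) h|^2 = |z|^2 |h|^2, a consequence of the CAR.

   In f wedge_2 f only terms with the same two functions on both sides survive
   by orthogonality, and a wedge product with a repeated factor is 0. *)
From mathcomp Require Import all_boot all_order all_algebra perm ring_quotient.
From mathcomp Require Import complex.
From mathcomp Require Import all_classical all_reals all_analysis.
From mathcomp Require Import measurable_realfun ring lra.
Require Import Defs.

Set Implicit Arguments.
Unset Strict Implicit.
Unset Printing Implicit Defensive.
Import Order.TTheory GRing.Theory Num.Theory.
Import numFieldNormedType.Exports.

Local Open Scope classical_set_scope.
Local Open Scope complex_scope.
Local Open Scope ring_scope.

(** * Exterior products on lists and tuples *)

(** The claim on [K_fun] concerns every [F] that represents the chaos, not only the product of the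
    four Psi(f_i). Going through an operator of the commutant settles all of them at once:
    [F (F vacuum)] is then determined by the value of [F] at the vacuum, with no appeal to the
    faithfulness of the trace. [Psi_set] likewise ranges over all operators with the defining
    properties of b^* and b. Hence concrete operators are not enough; they must also be shown to be
    the only ones, by density of finite-particle vectors for creation and by nondegeneracy of the
    inner product for annihilation. Vectors are classes of families of functions, so every identity
    is first proved on representatives. Those on creation alone are algebraic and hold at every
    tuple. Those with annihilation integrate a slice, which is square integrable only for almost
    every value of the remaining variables, so most of them hold only almost everywhere. *)

Lemma sum_perm_lift (V : nmodType) n (F : 'S_n.+1 -> V) :
  \sum_s F s = \sum_(i < n.+1) \sum_(r : 'S_n) F (lift_perm ord0 i r).
Proof.
rewrite pair_big /= (reindex (fun p : 'I_n.+1 * 'S_n => lift_perm ord0 p.1 p.2))//.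
(* Both sides have (n+1)! elements, so injectivity suffices. *)
apply: onW_bij; apply: inj_card_bij.
  move=> [i r] [j q] /= /permP E.
  have := E ord0; rewrite !lift_perm_id => ij; rewrite -{j}ij in E *.
  congr (_, _); apply/permP => k.
  by have := E (lift ord0 k); rewrite !lift_perm_lift => /lift_inj.
by rewrite card_prod !card_Sn card_ord factS.
Qed.

(** * Deleting an entry of a tuple and moving it to the front *)

Section deletion.
Context {T : Type}.

Definition deltuple n (t : n.+1.-tuple T) (i : 'I_n.+1) : n.-tuple T :=
  [tuple tnth t (lift i j) | j < n].

(** Wedging with a function of one variable only chooses which variable that function receives, so
    these are the only rearrangements under which the measure has to be invariant. *)
Definition tofront n (i : 'I_n.+1) (t : n.+1.-tuple T) : n.+1.-tuple T :=
  [tuple of tnth t i :: deltuple t i].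

Lemma tnth_cons n (a : T) (u : n.-tuple T) (j : 'I_n) :
  tnth [tuple of a :: u] (lift ord0 j) = tnth u j.
Proof. by rewrite !(tnth_nth a). Qed.

Lemma deltuple_cons0 n (a : T) (u : n.-tuple T) :
  deltuple [tuple of a :: u] ord0 = u.
Proof. by apply: eq_from_tnth => j; rewrite tnth_mktuple tnth_cons. Qed.

Lemma deltuple_consS n (a : T) (u : n.+1.-tuple T) (i : 'I_n.+1) :
  deltuple [tuple of a :: u] (lift ord0 i) = [tuple of a :: deltuple u i].
Proof.
apply: eq_from_tnth => j; rewrite tnth_mktuple.
case: (unliftP ord0 j) => [k ->|->].
  rewrite [RHS]tnth_cons tnth_mktuple -[RHS](tnth_cons a); congr (tnth _ _).
  by apply: val_inj; rewrite /= /bump !leq0n !add1n ltnS addnS.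
by rewrite !(tnth_nth a).
Qed.

Lemma tuple_cons n (t : n.+1.-tuple T) :
  t = [tuple of thead t :: [tuple of behead t]].
Proof. exact: tuple_eta. Qed.

End deletion.

Section exterior.
Context {R : realType}.
Local Notation rT := (measurableTypeR R).
Local Notation C := R[i].

(* On tuples of size n+1, [ext z x] is (n+1) times the wedge product of z with
   the degree-n component of x (see [wedge_fun1] and [extE]). *)
Fixpoint ext (z : rT -> C) (x : seq rT -> C) (t : seq rT) : C :=
  if t is a :: u then z a * x u - ext z (fun v => x (a :: v)) u else 0.

Lemma extE z x n (t : n.+1.-tuple rT) :
  ext z x t = \sum_(i < n.+1) (-1) ^+ i * (z (tnth t i) * x (deltuple t i)).
Proof.
elim: n => [|n IH] in x t *; rewrite (tuple_cons t).
  rewrite big_ord1 deltuple_cons0 expr0 mul1r.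
  by case: (tupleP t) => a u; rewrite tuple0 /= subr0.
rewrite big_ord_recl deltuple_cons0 expr0 mul1r [LHS]/=; congr (_ + _).
rewrite (IH (fun v => x (thead t :: v)) [tuple of behead t]) -sumrN.
apply: eq_bigr => i _; rewrite deltuple_consS tnth_cons.
by rewrite -mulNr lift0 exprS mulN1r.
Qed.

Lemma eq_ext z x y n (t : seq rT) : size t = n.+1 ->
  (forall v, size v = n -> x v = y v) -> ext z x t = ext z y t.
Proof.
elim: t n x y => //= a u IH n x y [un] xy; rewrite xy//.
case: n => [|n] in xy un *; first by move/size0nil: un => ->.
by rewrite (IH n _ (fun v => y (a :: v)))// => v vn; apply: xy; rewrite /= vn.
Qed.

Lemma extP z (c : C) x y t :
  ext z (fun v => c * x v + y v) t = c * ext z x t + ext z y t.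
Proof.
elim: t x y => [|a u IH] x y /=; first by rewrite mulr0 addr0.
rewrite IH; ring.
Qed.

Lemma extB z (c : C) x y t :
  ext z (fun v => c * x v - y v) t = c * ext z x t - ext z y t.
Proof.
elim: t x y => [|a u IH] x y /=; first by rewrite mulr0 subr0.
rewrite IH; ring.
Qed.

(** After [extB], the mixed terms [z a * ext w x u] and [w a * ext z x u] occur on both sides with
    matching signs; what is left is the induction hypothesis for the functions with first argument
    [a] fixed. *)
Lemma ext_comm z w x t : ext z (ext w x) t = - ext w (ext z x) t.
Proof.
elim: t x => [|a u IH] x /=; first by rewrite oppr0.
rewrite !extB IH; ring.
Qed.

Lemma antisym_antisym n (h : n.-tuple rT -> C) s t :
  antisym h (permt s t) = (-1) ^+ s * antisym h t.
Proof.
rewrite /antisym mulrCA; congr (_ * _).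
rewrite (reindex_inj (mulIg s^-1)%g) /= mulr_sumr; apply: eq_bigr => r _.
rewrite odd_permM odd_permV signr_addb [RHS]mulrA.
rewrite [(-1) ^+ r * _]mulrC; congr (_ * h _).
by apply: eq_from_tnth => i; rewrite !tnth_mktuple permM permKV.
Qed.

Lemma tofrontE n (t : n.+1.-tuple rT) i : tofront i t = permt (lift_perm ord0 i 1) t.
Proof.
apply: eq_from_tnth => j; rewrite tnth_mktuple.
case: (unliftP ord0 j) => [k ->|->].
  by rewrite tnth_cons tnth_mktuple lift_perm_lift perm1.
by rewrite lift_perm_id.
Qed.

(** Group the permutations by the variable given to [z]. The n! permutations of the others
    contribute equally, by antisymmetry of [w], which turns 1/(n+1)! into 1/(n+1). *)
Lemma wedge_fun1 n z (w : n.-tuple rT -> C) (t : n.+1.-tuple rT) :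
  (forall s t, w (permt s t) = (-1) ^+ s * w t) ->
  wedge (fun1 z) w t = n.+1%:R^-1 *
    \sum_(i < n.+1) (-1) ^+ i * (z (tnth t i) * w (deltuple t i)).
Proof.
move=> aw; rewrite /wedge /antisym.
rewrite [X in _ * X = _](_ : _ = \sum_(i < n.+1) \sum_(r : 'S_n)
    (-1) ^+ i * (z (tnth t i) * w (deltuple t i))); last first.
  rewrite (sum_perm_lift (fun s : 'S_n.+1 => (-1) ^+ s * _)).
  apply: eq_bigr => i _; apply: eq_bigr => r _.
  rewrite odd_lift_perm /= signr_addb signr_odd -mulrA; congr (_ * _).
  rewrite /tensor /fun1 mulrCA; congr (_ * _).
    rewrite /thead !tnth_mktuple.
    have E0 : lshift n (ord0 : 'I_1) = (ord0 : 'I_n.+1) :> 'I_n.+1 by exact: val_inj.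
    by rewrite E0 lift_perm_id.
  transitivity ((-1) ^+ r * w (permt r (deltuple t i))).
    congr (_ * w _); apply: eq_from_tnth => j; rewrite !tnth_mktuple.
    have Ej : rshift 1 j = lift (ord0 : 'I_n.+1) j :> 'I_n.+1 by exact: val_inj.
    by rewrite Ej lift_perm_lift.
  by rewrite aw mulrA -signr_addb addbb mul1r.
under eq_bigr do rewrite sumr_const card_Sn -mulr_natl.
rewrite -mulr_sumr mulrA; congr (_ * _).
rewrite [(1 + n)%N]add1n factS natrM invfM -mulrA mulVf ?mulr1//.
Qed.

Lemma bigwedgeE n (f : 'I_n -> rT -> C) t :
  bigwedge f t = (n`!%:R)^-1 * \det (\matrix_(i, j) f i (tnth t j)).
Proof.
congr (_ * _); apply: eq_bigr => s _; congr (_ * _); apply: eq_bigr => i _.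
by rewrite mxE tnth_mktuple.
Qed.

(** Laplace expansion along the first row. The right-hand side has the shape of [wedge_fun1], so
    that iterated creation from the vacuum builds [bigwedge]. *)
Lemma bigwedge_recl n (f : 'I_n.+1 -> rT -> C) t :
  bigwedge f t = n.+1%:R^-1 * \sum_(i < n.+1) (-1) ^+ i *
    (f ord0 (tnth t i) * bigwedge (fun j => f (lift ord0 j)) (deltuple t i)).
Proof.
rewrite bigwedgeE (expand_det_row _ ord0) factS natrM invfM -mulrA; congr (_ * _).
rewrite mulr_sumr; apply: eq_bigr => i _.
rewrite mxE /cofactor add0n bigwedgeE mulrCA mulrA [RHS]mulrCA mulrA.
rewrite -[RHS]mulrA -[LHS]mulrA; congr (_ * _); rewrite mulrCA; congr (_ * _).
congr (_ * _); congr (\det _); apply/matrixP => j k.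
by rewrite !mxE tnth_mktuple.
Qed.

End exterior.

(** * Complex integrals and L2 *)

Local Notation normc := ComplexField.Normc.normc.

Section complex_integral.
Context d (T : measurableType d) {R : realType}.
Variable m : {measure set T -> \bar R}.
Implicit Types f g h : T -> R[i].

Definition measurableC f :=
  measurable_fun setT (fun x => complex.Re (f x)) /\
  measurable_fun setT (fun x => complex.Im (f x)).

Definition integrableC f :=
  m.-integrable setT (fun x => (complex.Re (f x))%:E) /\
  m.-integrable setT (fun x => (complex.Im (f x))%:E).

Lemma complex_ReM (a b : R[i]) : complex.Re (a * b) =
  complex.Re a * complex.Re b - complex.Im a * complex.Im b.
Proof. by case: a b => [? ?] [? ?]. Qed.

Lemma complex_ImM (a b : R[i]) : complex.Im (a * b) =
  complex.Re a * complex.Im b + complex.Im a * complex.Re b.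
Proof. by case: a b => [? ?] [? ?]. Qed.

Lemma complex_ReD (a b : R[i]) : complex.Re (a + b) = complex.Re a + complex.Re b.
Proof. by case: a b => [? ?] [? ?]. Qed.

Lemma complex_ImD (a b : R[i]) : complex.Im (a + b) = complex.Im a + complex.Im b.
Proof. by case: a b => [? ?] [? ?]. Qed.

Lemma complex_Re_conj (a : R[i]) : complex.Re (conjc a) = complex.Re a.
Proof. by case: a. Qed.

Lemma complex_Im_conj (a : R[i]) : complex.Im (conjc a) = - complex.Im a.
Proof. by case: a. Qed.

Lemma normc_conj (a : R[i]) : normc (conjc a) = normc a.
Proof. by case: a => a b /=; rewrite sqrrN. Qed.

Lemma complex_ext (a b : R[i]) :
  complex.Re a = complex.Re b -> complex.Im a = complex.Im b -> a = b.
Proof. by case: a b => [? ?] [? ?] /= -> ->. Qed.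

Lemma conjcD (a b : R[i]) : conjc (a + b) = conjc a + conjc b.
Proof. by case: a b => [? ?] [? ?]; apply: complex_ext => /=; ring. Qed.

Lemma conjcM (a b : R[i]) : conjc (a * b) = conjc a * conjc b.
Proof. by case: a b => [? ?] [? ?]; apply: complex_ext => /=; ring. Qed.

Lemma measurableC_cst (c : R[i]) : measurableC (fun=> c).
Proof. by split; exact: measurable_cst. Qed.

Lemma measurableCM f g : measurableC f -> measurableC g ->
  measurableC (fun x => f x * g x).
Proof.
move=> [fr fi] [gr gi]; split.
  under eq_fun do rewrite complex_ReM.
  by apply: measurable_funB; exact: measurable_funM.
under eq_fun do rewrite complex_ImM.
by apply: measurable_funD; exact: measurable_funM.
Qed.

Lemma measurableC_conj f : measurableC f -> measurableC (fun x => conjc (f x)).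
Proof.
move=> [fr fi]; split; first by under eq_fun do rewrite complex_Re_conj.
by under eq_fun do rewrite complex_Im_conj; exact: measurableT_comp.
Qed.

Lemma L2fun_measurable f : L2fun m f -> measurableC f.
Proof. by move=> [/andP[/[!inE] mr _] /andP[/[!inE] mi _]]. Qed.

Lemma measurable_normc2 f : measurableC f ->
  measurable_fun setT (fun x => ((normc (f x)) ^+ 2)%:E).
Proof.
move=> [mr mi]; apply/measurable_EFinP; under eq_fun do rewrite normc_sqr.
by apply: measurable_funD; exact: measurable_funX.
Qed.

Lemma normc2_ge0 (z : R[i]) : (0 <= (normc z ^+ 2)%:E)%E.
Proof. by rewrite lee_fin sqr_ge0. Qed.

Lemma Lfun2P (u : T -> R) : measurable_fun setT u ->
  (\int[m]_x (u x ^+ 2)%:E < +oo)%E -> u \in Lfun m 2%:E.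
Proof.
move=> mu uoo; rewrite inE; apply/andP; split; rewrite inE//= /finite_norm.
rewrite unlock /=; apply: poweR_lty.
apply: le_lt_trans uoo; rewrite le_eqVlt; apply/orP; left; apply/eqP.
apply: eq_integral => x _; rewrite powR_mulrn//.
by congr EFin; rewrite -normrX ger0_norm// sqr_ge0.
Qed.

Lemma L2funE f : L2fun m f <->
  measurableC f /\ (\int[m]_x (normc (f x) ^+ 2)%:E < +oo)%E.
Proof.
split=> [Lf|[[mr mi] foo]].
  split; first exact: L2fun_measurable.
  have [Lr Li] := Lf.
  under eq_integral do rewrite normc_sqr.
  have /integrableP[_] := integrableD measurableT (Lfun2_integrable_sqr Lr)
    (Lfun2_integrable_sqr Li).
  apply: le_lt_trans; rewrite le_eqVlt; apply/orP; left; apply/eqP.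
  by apply: eq_integral => t _; rewrite /= ger0_norm// addr_ge0 ?sqr_ge0.
have mf : measurable_fun setT (fun x => ((normc (f x)) ^+ 2)%:E).
  exact: measurable_normc2.
split; apply: Lfun2P => //; apply: le_lt_trans foo.
  apply: ge0_le_integral => //.
  - by move=> x _; rewrite lee_fin sqr_ge0.
  - by apply/measurable_EFinP; exact: measurable_funX.
  - by move=> x _; rewrite lee_fin normc_sqr lerDl sqr_ge0.
apply: ge0_le_integral => //.
- by move=> x _; rewrite lee_fin sqr_ge0.
- by apply/measurable_EFinP; exact: measurable_funX.
- by move=> x _; rewrite lee_fin normc_sqr lerDr sqr_ge0.
Qed.

Lemma L2funM f g : L2fun m f -> L2fun m g -> integrableC (fun x => f x * g x).
Proof.
move=> [fr fi] [gr gi].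
have E u v : u \in Lfun m 2%:E -> v \in Lfun m 2%:E ->
    m.-integrable setT (fun x => (u x * v x)%:E).
  by move=> Lu Lv; apply/(Lfun1_integrable m (fun x => u x * v x)); exact: Lfun2_mul_Lfun1.
split.
  under eq_fun do rewrite complex_ReM EFinB.
  by apply: integrableB => //; exact: E.
under eq_fun do rewrite complex_ImM EFinD.
by apply: integrableD => //; exact: E.
Qed.

Lemma L2fun_conj f : L2fun m f -> L2fun m (fun x => conjc (f x)).
Proof.
move=> /L2funE[mf foo]; apply/L2funE; split; first exact: measurableC_conj.
by under eq_integral do rewrite normc_conj.
Qed.

Lemma L2funZ (a : R[i]) f : L2fun m f -> L2fun m (fun x => a * f x).
Proof.
move=> Lf; have := L2funP a Lf (L2fun0 m).
by under eq_fun do rewrite addr0.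
Qed.

Lemma L2fun_sum I (r : seq I) (P : pred I) (F : I -> T -> R[i]) :
  (forall i, P i -> L2fun m (F i)) -> L2fun m (fun x => \sum_(i <- r | P i) F i x).
Proof.
move=> LF; elim: r => [|i r IH].
  by under eq_fun do rewrite big_nil; exact: L2fun0.
under eq_fun do rewrite big_cons.
case: (boolP (P i)) => Pi //.
have := L2funP 1 (LF _ Pi) IH.
by under eq_fun do rewrite mul1r.
Qed.

Lemma integrableCP (c : R[i]) f g : integrableC f -> integrableC g ->
  integrableC (fun x => c * f x + g x).
Proof.
move=> [fr fi] [gr gi]; split.
  under eq_fun do rewrite complex_ReD complex_ReM EFinD EFinB !EFinM.
  apply: integrableD => //; apply: integrableB => //; exact: integrableZl.
under eq_fun do rewrite complex_ImD complex_ImM !EFinD !EFinM.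
apply: integrableD => //; apply: integrableD => //; exact: integrableZl.
Qed.

Lemma cintegralP (c : R[i]) f g : integrableC f -> integrableC g ->
  cintegral m (fun x => c * f x + g x) = c * cintegral m f + cintegral m g.
Proof.
move=> [fr fi] [gr gi]; rewrite /cintegral.
have Z k u : m.-integrable setT (fun x => (u x)%:E) ->
    m.-integrable setT (fun x => (k * u x)%:E).
  by move=> iu; under eq_fun do rewrite EFinM; exact: integrableZl.
have B u v : m.-integrable setT (fun x => (u x)%:E) ->
    m.-integrable setT (fun x => (v x)%:E) ->
    m.-integrable setT (fun x => (u x - v x)%:E).
  by move=> iu iv; under eq_fun do rewrite EFinB; exact: integrableB.
have D u v : m.-integrable setT (fun x => (u x)%:E) ->
    m.-integrable setT (fun x => (v x)%:E) ->
    m.-integrable setT (fun x => (u x + v x)%:E).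
  by move=> iu iv; under eq_fun do rewrite EFinD; exact: integrableD.
apply: complex_ext; rewrite ?complex_ReD ?complex_ImD ?complex_ReM ?complex_ImM /=.
  under eq_Rintegral do rewrite complex_ReD complex_ReM.
  rewrite RintegralD//; [|by apply: B; exact: Z].
  rewrite RintegralB//; try exact: Z.
  by rewrite !RintegralZl.
under eq_Rintegral do rewrite complex_ImD complex_ImM.
rewrite RintegralD//; [|by apply: D; exact: Z].
rewrite RintegralD//; try exact: Z.
by rewrite !RintegralZl.
Qed.

Lemma integrableC0 : integrableC (fun=> 0).
Proof. by split; exact: integrable0. Qed.

Lemma cintegral0 : cintegral m (fun=> 0) = 0.
Proof. by rewrite /cintegral /Rintegral !integral0. Qed.

Lemma integrableCZ (c : R[i]) f : integrableC f -> integrableC (fun x => c * f x).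
Proof.
move=> If; have := integrableCP c If integrableC0.
by under eq_fun do rewrite addr0.
Qed.

Lemma cintegralZ (c : R[i]) f : integrableC f ->
  cintegral m (fun x => c * f x) = c * cintegral m f.
Proof.
move=> If; have := cintegralP c If integrableC0.
by under eq_fun do rewrite addr0; rewrite cintegral0 addr0.
Qed.

Lemma cintegralD f g : integrableC f -> integrableC g ->
  cintegral m (fun x => f x + g x) = cintegral m f + cintegral m g.
Proof.
move=> If Ig; have := cintegralP 1 If Ig.
by under eq_fun do rewrite mul1r; rewrite mul1r.
Qed.

Lemma integrableC_sum I (r : seq I) (P : pred I) (F : I -> T -> R[i]) :
  (forall i, P i -> integrableC (F i)) ->
  integrableC (fun x => \sum_(i <- r | P i) F i x).
Proof.
move=> IF; elim: r => [|i r IH].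
  by under eq_fun do rewrite big_nil; exact: integrableC0.
under eq_fun do rewrite big_cons.
case: (boolP (P i)) => Pi //.
have := integrableCP 1 (IF _ Pi) IH.
by under eq_fun do rewrite mul1r.
Qed.

Lemma cintegral_sum I (r : seq I) (P : pred I) (F : I -> T -> R[i]) :
  (forall i, P i -> integrableC (F i)) ->
  cintegral m (fun x => \sum_(i <- r | P i) F i x) =
  \sum_(i <- r | P i) cintegral m (F i).
Proof.
move=> IF; elim: r => [|i r IH].
  by rewrite big_nil; under eq_fun do rewrite big_nil; exact: cintegral0.
under eq_fun do rewrite big_cons.
rewrite big_cons; case: (boolP (P i)) => Pi //.
by rewrite cintegralD ?IH//; [exact: IF|exact: integrableC_sum].
Qed.

Lemma eq_cintegral f g : f =1 g -> cintegral m f = cintegral m g.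
Proof. by move=> /funext ->. Qed.

Lemma cintegral_conj f : integrableC f ->
  cintegral m (fun x => conjc (f x)) = conjc (cintegral m f).
Proof.
move=> [fr fi]; rewrite /cintegral; apply: complex_ext => /=.
  by apply: eq_Rintegral => x _; rewrite complex_Re_conj.
under eq_Rintegral do rewrite complex_Im_conj -mulN1r.
by rewrite RintegralZl// mulN1r.
Qed.

Lemma ae_cintegral f g : measurableC f -> measurableC g ->
  f = g %[ae m] -> cintegral m f = cintegral m g.
Proof.
move=> [fr fi] [gr gi] fg; apply: complex_ext; congr fine.
  apply: ae_eq_integral => //; [exact/measurable_EFinP..|].
  by apply: filterS fg => x /= fgx /fgx ->.
apply: ae_eq_integral => //; [exact/measurable_EFinP..|].
by apply: filterS fg => x /= fgx /fgx ->.
Qed.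

Lemma L2ipP f (c : R[i]) g h : L2fun m f -> L2fun m g -> L2fun m h ->
  L2ip m f (fun x => c * g x + h x) = c * L2ip m f g + L2ip m f h.
Proof.
move=> Lf Lg Lh; rewrite /L2ip -cintegralP; last 2 first.
- by apply: L2funM => //; exact: L2fun_conj.
- by apply: L2funM => //; exact: L2fun_conj.
apply: eq_cintegral => x; ring.
Qed.

Lemma L2ipC f g : L2fun m f -> L2fun m g -> L2ip m g f = conjc (L2ip m f g).
Proof.
move=> Lf Lg; rewrite /L2ip -cintegral_conj; last first.
  by apply: L2funM => //; exact: L2fun_conj.
by apply: eq_cintegral => x; rewrite conjcM conjcK mulrC.
Qed.

Lemma L2ipPl (c : R[i]) f g h : L2fun m f -> L2fun m g -> L2fun m h ->
  L2ip m (fun x => c * g x + h x) f = conjc c * L2ip m g f + L2ip m h f.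
Proof.
move=> Lf Lg Lh; rewrite L2ipC//; last exact: L2funP.
by rewrite L2ipP// conjcD conjcM -!L2ipC.
Qed.

Lemma ae_L2ip f f' g g' : L2fun m f -> L2fun m g -> L2fun m f' -> L2fun m g' ->
  f = f' %[ae m] -> g = g' %[ae m] -> L2ip m f g = L2ip m f' g'.
Proof.
move=> Lf Lg Lf' Lg' ff' gg'; apply: ae_cintegral.
- by apply: measurableCM; [apply: measurableC_conj|]; exact: L2fun_measurable.
- by apply: measurableCM; [apply: measurableC_conj|]; exact: L2fun_measurable.
by apply: filterS2 ff' gg' => x /= e1 e2 _; rewrite e1// e2.
Qed.

(** Since [fine] sends +oo to 0, this is the squared norm only for functions in L2. *)
Definition sqnorm f : R := fine (L2norm m f ^+ 2).

Lemma L2norm_sqrE f : L2fun m f -> (L2norm m f ^+ 2 = (sqnorm f)%:E)%E.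
Proof.
move=> /L2funE[_ foo]; rewrite /sqnorm fineK// L2norm_sqr ge0_fin_numE//.
by apply: integral_ge0 => x _; exact: normc2_ge0.
Qed.

Lemma sqnorm_ge0 f : 0 <= sqnorm f.
Proof.
by rewrite fine_ge0// L2norm_sqr; apply: integral_ge0 => x _; exact: normc2_ge0.
Qed.

Lemma L2ip_sqnorm f : L2ip m f f = (sqnorm f)%:C.
Proof.
rewrite /sqnorm L2norm_sqr; apply: complex_ext => /=.
  congr fine; apply: eq_integral => x _.
  by rewrite complex_ReM complex_Re_conj complex_Im_conj normc_sqr mulNr opprK.
rewrite /Rintegral (eq_integral (cst 0%E)) ?integral0// => x _.
by rewrite complex_ImM complex_Re_conj complex_Im_conj mulNr mulrC subrr.
Qed.

Lemma sqnorm_eq0 f : L2fun m f -> sqnorm f = 0 -> f = (fun=> 0) %[ae m].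
Proof.
move=> Lf f0; have := L2norm_sqrE Lf; rewrite f0 L2norm_sqr => /eqP.
have mf := measurable_normc2 (L2fun_measurable Lf).
rewrite (eq_integral (fun x => `| (normc (f x) ^+ 2)%:E|)%E); last first.
  by move=> x _; rewrite gee0_abs// normc2_ge0.
move/eqP/(ae_eq_integral_abs m measurableT mf).1.
apply: filterS => x /= fx0 _; have := fx0 I.
by move=> [] /eqP; rewrite sqrf_eq0 => /eqP /ComplexField.Normc.eq0_normc.
Qed.

(** The squared norm of g - t c f, with c = <f, g>, is a nonnegative polynomial in the real number
    t. At t = 1/|f|^2 this is the claim. If |f| = 0 the polynomial is affine, and the value of t
    chosen below would make it -1 unless c = 0. *)
Lemma cauchy_schwarz f g : L2fun m f -> L2fun m g ->
  normc (L2ip m f g) ^+ 2 <= sqnorm f * sqnorm g.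
Proof.
move=> Lf Lg; set c := L2ip m f g; set n := normc c ^+ 2.
have E (t : R) : 0 <= sqnorm g - 2 * t * n + t ^+ 2 * n * sqnorm f.
  have L1 := L2funP (- (t%:C * c)) Lf Lg.
  have := sqnorm_ge0 (fun x => - (t%:C * c) * f x + g x).
  rewrite -lecR -L2ip_sqnorm L2ipP// !L2ipPl// !L2ip_sqnorm -/c (L2ipC Lf Lg) -/c.
  rewrite lecE => /andP[_].
  have nE : n = complex.Re c ^+ 2 + complex.Im c ^+ 2 by exact: normc_sqr.
  by rewrite nE; case: (c) => a b /=; lra.
have [f0|f0] := eqVneq (sqnorm f) 0.
  rewrite f0 mul0r.
  rewrite leNgt; apply/negP => n0.
  have := E ((sqnorm g + 1) / (2 * n)); rewrite f0 mulr0 addr0.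
  rewrite (_ : 2 * _ * n = sqnorm g + 1); last by field; rewrite gt_eqF.
  by rewrite opprD addrA subrr add0r oppr_ge0 ler10.
have fp : 0 < sqnorm f by rewrite lt_neqAle eq_sym f0 sqnorm_ge0.
have := E (sqnorm f)^-1.
rewrite (_ : _ - _ + _ = sqnorm g - n / sqnorm f); last by field.
by rewrite subr_ge0 ler_pdivrMr// mulrC.
Qed.

End complex_integral.

(** * The measure on tuples *)

Section tuple_measure.
Context {R : realType}.
Local Notation rT := (measurableTypeR R).
Local Notation C := R[i].

Lemma measurable_consl n (u : n.-tuple rT) :
  measurable_fun setT (fun s : rT => [tuple of s :: u]).
Proof. by apply: measurable_cons; [exact: measurable_id|exact: measurable_cst]. Qed.

Lemma measurable_consr n (s : rT) :
  measurable_fun setT (fun u : n.-tuple rT => [tuple of s :: u]).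
Proof. by apply: measurable_cons; [exact: measurable_cst|exact: measurable_id]. Qed.

Lemma measurable_deltuple n (i : 'I_n.+1) :
  measurable_fun setT (fun t : n.+1.-tuple rT => deltuple t i).
Proof.
apply/measurable_fun_tnthP => j.
rewrite (_ : _ \o _ = fun t => tnth t (lift i j)); first exact: measurable_tnth.
by apply/funext => t; rewrite /= tnth_mktuple.
Qed.

Lemma measurable_tofront n (i : 'I_n.+1) :
  measurable_fun setT (tofront i : n.+1.-tuple rT -> n.+1.-tuple rT).
Proof.
apply: measurable_cons; first exact: measurable_tnth.
exact: measurable_deltuple.
Qed.

Lemma ge0_integral_consR n (f : n.+1.-tuple rT -> \bar R) :
  measurable_fun setT f -> (forall t, 0 <= f t)%E ->
  (\int[muRn n.+1]_t f t = \int[muR \x muRn n]_p f (consR p))%E.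
Proof.
move=> mf f0.
have := @ge0_integral_pushforward _ _ _ _ R (@consR R n) (@measurable_consR R n)
  (muR \x muRn n)%E setT f measurableT mf (fun t _ => f0 t).
rewrite preimage_setT => <-.
by apply: eq_measure_integral; first exact: measurable_consR.
Qed.

Opaque muRn.

Lemma ge0_integral_cons n (f : n.+1.-tuple rT -> \bar R) :
  measurable_fun setT f -> (forall t, 0 <= f t)%E ->
  (\int[muRn n.+1]_t f t = \int[muR]_s \int[muRn n]_u f [tuple of s :: u])%E.
Proof.
move=> mf f0; rewrite ge0_integral_consR// (fubini_tonelli1 (fun p => f (consR p)))//.
by apply: measurableT_comp => //; exact: measurable_consR.
Qed.

Lemma ge0_integral_consC n (f : n.+1.-tuple rT -> \bar R) :
  measurable_fun setT f -> (forall t, 0 <= f t)%E ->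
  (\int[muRn n.+1]_t f t = \int[muRn n]_u \int[muR]_s f [tuple of s :: u])%E.
Proof.
move=> mf f0; rewrite ge0_integral_consR// (fubini_tonelli2 (fun p => f (consR p)))//.
by apply: measurableT_comp => //; exact: measurable_consR.
Qed.

(** Moving entry j+1 of a :: u to the front amounts to moving entry j of [u] to the front, which is
    the induction hypothesis, and then exchanging the first two variables, which is Tonelli on the
    plane. *)
Lemma ge0_integral_tofront n (i : 'I_n.+1) (f : n.+1.-tuple rT -> \bar R) :
  measurable_fun setT f -> (forall t, 0 <= f t)%E ->
  (\int[muRn n.+1]_t f (tofront i t) = \int[muRn n.+1]_t f t)%E.
Proof.
elim: n => [|n IH] in i f *.
  move=> mf f0; apply: eq_integral => t _; congr f.
  by rewrite ord1 (tuple_cons t) /tofront deltuple_cons0; exact: val_inj.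
move=> mf f0.
case: (unliftP ord0 i) => [j ->|->]; last first.
  apply: eq_integral => t _; congr f.
  by rewrite (tuple_cons t) /tofront deltuple_cons0; exact: val_inj.
rewrite ge0_integral_cons//; last first.
  by apply: measurableT_comp => //; exact: measurable_tofront.
transitivity (\int[muR]_a \int[muRn n.+1]_u
    f [tuple of thead u :: [tuple of a :: [tuple of behead u]]])%E.
  apply: eq_integral => a _.
  rewrite -(IH j (fun u => f [tuple of thead u :: [tuple of a :: [tuple of behead u]]]))//.
    apply: eq_integral => u _; congr f.
    rewrite /tofront tnth_cons deltuple_consS; apply: val_inj => /=.
    by rewrite theadE.
  apply: measurableT_comp => //; apply: measurable_cons; first exact: measurable_tnth.
  by apply: measurable_cons; [exact: measurable_cst|exact: measurable_behead].
transitivity (\int[muR]_a \int[muR]_s \int[muRn n]_u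
    f [tuple of s :: [tuple of a :: u]])%E.
  apply: eq_integral => a _.
  have mfa : measurable_fun setT (fun u : n.+1.-tuple rT =>
      f [tuple of thead u :: [tuple of a :: [tuple of behead u]]]).
    apply: measurableT_comp mf _; apply: measurable_cons; first exact: measurable_tnth.
    by apply: measurable_cons; [exact: measurable_cst|exact: measurable_behead].
  rewrite (ge0_integral_cons mfa (fun _ => f0 _)).
  apply: eq_integral => s _; apply: eq_integral => u _; congr f.
  by apply: val_inj => /=; rewrite theadE.
rewrite (ge0_integral_cons mf f0).
transitivity (\int[muR]_s \int[muR]_a \int[muRn n]_u
    f [tuple of s :: [tuple of a :: u]])%E; last first.
  apply: eq_integral => s _; rewrite ge0_integral_cons//.
  by apply: measurableT_comp => //; exact: measurable_consr.
apply: (fubini_tonelli (fun p : rT * rT => \int[muRn n]_u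
    f [tuple of p.2 :: [tuple of p.1 :: u]])%E).
  apply: (measurable_fun_fubini_tonelli_F (fun q : (rT * rT) * n.-tuple rT =>
    f [tuple of q.1.2 :: [tuple of q.1.1 :: q.2]]))=> //.
  apply: measurableT_comp => //.
  apply: measurable_cons; first exact: measurableT_comp measurable_snd measurable_fst.
  apply: measurable_cons; last exact: measurable_snd.
  exact: measurableT_comp measurable_fst measurable_fst.
by move=> p; exact: integral_ge0.
Qed.

Lemma ae_cover d (T : measurableType d) (m : {measure set T -> \bar R}) (P : T -> Prop) :
  {ae m, forall x, P x} -> exists N, [/\ measurable N, m N = 0%E &
    forall x, ~ N x -> P x].
Proof.
move=> [N [mN N0 sub]]; exists N; split=> // x Nx.
by apply: contrapT => Px; exact/Nx/sub.
Qed.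

Lemma ae_uncover d (T : measurableType d) (m : {measure set T -> \bar R}) (P : T -> Prop) N :
  measurable N -> m N = 0%E -> (forall x, ~ N x -> P x) -> {ae m, forall x, P x}.
Proof.
move=> mN N0 NP; exists N; split => // x /= Px.
by apply: contrapT => Nx; exact/Px/NP.
Qed.

Lemma integral_indicT d (T : measurableType d) (m : {measure set T -> \bar R}) N :
  measurable N -> (\int[m]_x (\1_N x : R)%:E = m N)%E.
Proof. by move=> mN; rewrite integral_indic// setIT. Qed.

Lemma null_tofront n (i : 'I_n.+1) (N : set (n.+1.-tuple rT)) :
  measurable N -> muRn n.+1 N = 0%E ->
  measurable (tofront i @^-1` N) /\ muRn n.+1 (tofront i @^-1` N) = 0%E.
Proof.
move=> mN N0.
have mN' : measurable (tofront i @^-1` N).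
  by rewrite -[X in measurable X]setTI; exact: measurable_tofront.
split=> //; have mI : measurable_fun setT (fun t => (\1_N t : R)%:E).
  exact/measurable_EFinP/measurable_indic.
have I0 t : (0 <= (\1_N t : R)%:E)%E by rewrite lee_fin.
rewrite -(integral_indicT _ mN') -N0 -(integral_indicT _ mN).
by rewrite -(ge0_integral_tofront i mI I0).
Qed.

Lemma ae_tofront n (i : 'I_n.+1) (P : n.+1.-tuple rT -> Prop) :
  {ae muRn n.+1, forall t, P t} -> {ae muRn n.+1, forall t, P (tofront i t)}.
Proof.
move=> /ae_cover[N [mN N0 NP]].
have [mN' N0'] := null_tofront i mN N0.
by apply: (ae_uncover mN' N0') => x Nx; exact: NP.
Qed.

Lemma behead_cons n (s : rT) (u : n.-tuple rT) : [tuple of behead [tuple of s :: u]] = u.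
Proof. exact: val_inj. Qed.

Lemma ae_behead n (P : n.-tuple rT -> Prop) :
  {ae muRn n, forall u, P u} ->
  {ae muRn n.+1, forall t : n.+1.-tuple rT, P [tuple of behead t]}.
Proof.
move=> /ae_cover[N [mN N0 NP]].
pose N' := (fun t : n.+1.-tuple rT => [tuple of behead t]) @^-1` N.
have mN' : measurable N'.
  by rewrite -[X in measurable X]setTI; exact: measurable_behead.
apply: (@ae_uncover _ _ _ _ N') => //; last by move=> x Nx; exact: NP.
have mI : measurable_fun setT (fun t => (\1_N' t : R)%:E).
  exact/measurable_EFinP/measurable_indic.
rewrite -(setIT N') -integral_indic// ge0_integral_cons//.
apply: integral0_eq => s _.
rewrite (eq_integral (fun u => (\1_N u : R)%:E)); last first.
  move=> u _; congr (_%:E); rewrite !indicE; congr (_%:R); congr nat_of_bool.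
  by apply/idP/idP => /set_mem Nu; apply/mem_set; move: Nu;
    rewrite /N' /preimage /mkset behead_cons.
by rewrite integral_indic// setIT.
Qed.

Lemma ae_deltuple n (i : 'I_n.+1) (P : n.-tuple rT -> Prop) :
  {ae muRn n, forall u, P u} -> {ae muRn n.+1, forall t, P (deltuple t i)}.
Proof.
move=> /ae_behead/(ae_tofront i); apply: filterS => t.
have E : [tuple of behead (tofront i t)] = deltuple t i :> n.-tuple rT.
  exact: val_inj.
by move=> Pt; rewrite -E.
Qed.

(** Tonelli for the indicator of a null set: almost all of its sections are null. *)
Lemma ae_consr n (P : n.+1.-tuple rT -> Prop) :
  {ae muRn n.+1, forall t, P t} ->
  {ae muRn n, forall u : n.-tuple rT, {ae muR, forall s, P [tuple of s :: u]}}.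
Proof.
move=> /ae_cover[N [mN N0 NP]].
have mI : measurable_fun setT (fun t => (\1_N t : R)%:E).
  exact/measurable_EFinP/measurable_indic.
have I0 t : (0 <= (\1_N t : R)%:E)%E by rewrite lee_fin.
have mF : measurable_fun setT (fun u : n.-tuple rT =>
    \int[muR]_s (\1_N [tuple of s :: u] : R)%:E)%E.
  apply: (measurable_fun_fubini_tonelli_G (fun p => (\1_N (consR p) : R)%:E)) => //.
  by apply: (measurableT_comp mI); exact: measurable_consR.
have F0 (u : n.-tuple rT) : (0 <= \int[muR]_s (\1_N [tuple of s :: u] : R)%:E)%E.
  exact: integral_ge0.
have : (\int[muRn n]_u `| \int[muR]_s (\1_N [tuple of s :: u] : R)%:E | = 0)%E.
  under eq_integral do rewrite gee0_abs//.
  by rewrite -(ge0_integral_consC mI I0) integral_indicT.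
move/(ae_eq_integral_abs (muRn n) measurableT mF).1.
apply: filterS => u /= /(_ I) u0.
have mNu : measurable ((fun s : rT => [tuple of s :: u]) @^-1` N).
  by rewrite -[X in measurable X]setTI; exact: measurable_consl.
apply: (ae_uncover mNu); last by move=> s Ns; exact: NP.
by rewrite -(setIT (_ @^-1` _)) -integral_indic.
Qed.

Lemma integrableC_tofront n (i : 'I_n.+1) (f : n.+1.-tuple rT -> C) :
  integrableC (muRn n.+1) f -> integrableC (muRn n.+1) (fun t => f (tofront i t)).
Proof.
have E (u : n.+1.-tuple rT -> R) : (muRn n.+1).-integrable setT (fun x => (u x)%:E) ->
    (muRn n.+1).-integrable setT (fun x => (u (tofront i x))%:E).
  move=> /integrableP[mu uoo]; apply/integrableP; split.
    by apply: (measurableT_comp mu); exact: measurable_tofront.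
  rewrite (ge0_integral_tofront i (f := fun x => `|(u x)%:E|%E))//.
  exact: measurableT_comp.
by move=> [fr fi]; split;
  [exact: (E (fun t => complex.Re (f t)))|exact: (E (fun t => complex.Im (f t)))].
Qed.

Lemma cintegral_tofront n (i : 'I_n.+1) (f : n.+1.-tuple rT -> C) :
  measurableC f ->
  cintegral (muRn n.+1) (fun t => f (tofront i t)) = cintegral (muRn n.+1) f.
Proof.
have E (u : n.+1.-tuple rT -> \bar R) : measurable_fun setT u ->
    (\int[muRn n.+1]_t u (tofront i t) = \int[muRn n.+1]_t u t)%E.
  move=> mu; rewrite [LHS]integralE [RHS]integralE; congr (_ - _)%E.
    rewrite -(ge0_integral_tofront i (measurable_funepos mu))//.
    by rewrite -[X in (X^\+)%E]/(u \o tofront i) funepos_comp.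
  rewrite -(ge0_integral_tofront i (measurable_funeneg mu))//.
  by rewrite -[X in (X^\-)%E]/(u \o tofront i) funeneg_comp.
move=> [fr fi]; apply: complex_ext; congr fine.
  by rewrite (E (fun t => (complex.Re (f t))%:E))//; exact/measurable_EFinP.
by rewrite (E (fun t => (complex.Im (f t))%:E))//; exact/measurable_EFinP.
Qed.

Lemma L2fun_tofront n (i : 'I_n.+1) (f : n.+1.-tuple rT -> C) :
  L2fun (muRn n.+1) f -> L2fun (muRn n.+1) (fun t => f (tofront i t)).
Proof.
move=> /L2funE[[mr mi] foo]; apply/L2funE; split.
  by split; [apply: (measurableT_comp mr)|apply: (measurableT_comp mi)];
     exact: measurable_tofront.
rewrite (ge0_integral_tofront i (f := fun x => (normc (f x) ^+ 2)%:E))//.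
  exact: measurable_normc2.
by move=> t; exact: normc2_ge0.
Qed.

Definition ctensor n (z : rT -> C) (x : n.-tuple rT -> C) (t : n.+1.-tuple rT) : C :=
  z (thead t) * x [tuple of behead t].

Lemma measurableC_ctensor n z (x : n.-tuple rT -> C) :
  measurableC z -> measurableC x -> measurableC (ctensor z x).
Proof.
move=> [zr zi] [xr xi]; apply: measurableCM.
  by split; [apply: (measurableT_comp zr)|apply: (measurableT_comp zi)];
     exact: measurable_tnth.
by split; [apply: (measurableT_comp xr)|apply: (measurableT_comp xi)];
     exact: measurable_behead.
Qed.

Lemma normcM2 (a b : C) : normc (a * b) ^+ 2 = normc a ^+ 2 * normc b ^+ 2.
Proof. by rewrite !normc_sqr; case: a b => [a a'] [b b'] /=; ring. Qed.

Lemma L2fun_ctensor n z (x : n.-tuple rT -> C) :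
  L2fun muR z -> L2fun (muRn n) x -> L2fun (muRn n.+1) (ctensor z x).
Proof.
move=> /L2funE[mz zoo] /L2funE[mx xoo].
have mzx := measurableC_ctensor mz mx.
apply/L2funE; split=> //; rewrite ge0_integral_cons; last 2 first.
- exact: measurable_normc2.
- by move=> t; exact: normc2_ge0.
under eq_integral => s _.
  under eq_integral => u _.
    rewrite /ctensor normcM2 theadE behead_cons EFinM.
    over.
  rewrite ge0_integralZl_EFin ?sqr_ge0//; last 2 first.
  - by move=> u _; exact: normc2_ge0.
  - exact: measurable_normc2.
  over.
rewrite ge0_integralZr//; last 3 first.
- exact: measurable_normc2.
- by move=> u _; exact: normc2_ge0.
- by apply: integral_ge0 => u _; exact: normc2_ge0.
have z0 : (0 <= \int[muR]_s (normc (z s) ^+ 2)%:E)%E.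
  by apply: integral_ge0 => u _; exact: normc2_ge0.
by apply: lte_mul_pinfty => //; rewrite ge0_fin_numE.
Qed.

(** By Tonelli the squared norm of the slice is an integrable function of [u], hence finite almost
    everywhere. *)
Lemma L2fun_consr n (k : n.+1.-tuple rT -> C) : L2fun (muRn n.+1) k ->
  {ae muRn n, forall u : n.-tuple rT, L2fun muR (fun s => k [tuple of s :: u])}.
Proof.
move=> /L2funE[[mr mi] koo].
have mk := measurable_normc2 (conj mr mi).
have mF : measurable_fun setT (fun u : n.-tuple rT =>
    \int[muR]_s (normc (k [tuple of s :: u]) ^+ 2)%:E)%E.
  apply: (measurable_fun_fubini_tonelli_G (fun p => (normc (k (consR p)) ^+ 2)%:E)) => //.
    by apply: (measurableT_comp mk); exact: measurable_consR.
  by move=> t; exact: normc2_ge0.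
have F0 (u : n.-tuple rT) : (0 <= \int[muR]_s (normc (k [tuple of s :: u]) ^+ 2)%:E)%E.
  by apply: integral_ge0 => s _; exact: normc2_ge0.
have : (muRn n).-integrable setT (fun u : n.-tuple rT =>
    \int[muR]_s (normc (k [tuple of s :: u]) ^+ 2)%:E)%E.
  apply/integrableP; split=> //; under eq_integral do rewrite gee0_abs//.
  by rewrite -(ge0_integral_consC mk (fun t => normc2_ge0 _)).
move/(integrable_ae measurableT); apply: filterS => u /= /(_ I) ufin.
apply/L2funE; split.
  by split; [apply: (measurableT_comp mr)|apply: (measurableT_comp mi)];
     exact: measurable_consl.
by rewrite -ge0_fin_numE.
Qed.

Lemma integrable_consR n (f : n.+1.-tuple rT -> R) :
  (muRn n.+1).-integrable setT (fun t => (f t)%:E) ->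
  (muR \x muRn n)%E.-integrable setT (fun p => (f (consR p))%:E).
Proof.
move=> /integrableP[mf foo]; apply/integrableP; split.
  by apply: (measurableT_comp mf); exact: measurable_consR.
rewrite -(ge0_integral_consR (f := fun t => `|(f t)%:E|%E))//.
exact: measurableT_comp.
Qed.

Lemma integral_consR n (f : n.+1.-tuple rT -> R) :
  measurable_fun setT f ->
  (\int[muRn n.+1]_t (f t)%:E = \int[muR \x muRn n]_p (f (consR p))%:E)%E.
Proof.
move=> mf; have mf' : measurable_fun setT (fun t => (f t)%:E) by exact/measurable_EFinP.
rewrite [LHS]integralE [RHS]integralE; congr (_ - _)%E.
  rewrite (ge0_integral_consR (measurable_funepos mf'))//.
  by under [RHS]eq_integral => p _ do rewrite (funepos_comp (EFin \o f) (@consR R n)).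
rewrite (ge0_integral_consR (measurable_funeneg mf'))//.
by under [RHS]eq_integral => p _ do rewrite (funeneg_comp (EFin \o f) (@consR R n)).
Qed.

(** The inner integrals of [cintegral] pass through [fine], which agrees with the extended integral
    only where the slice is integrable; Fubini makes the exceptional set null. *)
Lemma cintegral_consC n (f : n.+1.-tuple rT -> C) : integrableC (muRn n.+1) f ->
  cintegral (muRn n.+1) f =
  cintegral (muRn n) (fun u : n.-tuple rT => cintegral muR (fun s => f [tuple of s :: u])).
Proof.
have E (u : n.+1.-tuple rT -> R) :
    (muRn n.+1).-integrable setT (fun x => (u x)%:E) ->
    (\int[muRn n.+1]_t u t = \int[muRn n]_v \int[muR]_s u [tuple of s :: v])%R.
  move=> iu; have iu' := integrable_consR iu.
  rewrite {1}/Rintegral integral_consR; last first.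
    exact/measurable_EFinP/measurable_int/iu.
  rewrite -(integral21_prod_meas1 iu') /Rintegral; congr fine.
  apply: ae_eq_integral => //.
  - exact: measurable_fubini_G iu'.
  - apply/measurable_EFinP; apply: measurableT_comp => //.
    exact: (measurable_fubini_G iu').
  apply: filterS (ae_integrable2 iu') => v iv _.
  rewrite fineK//; exact: integrable_fin_num iv.
by move=> [fr fi]; apply: complex_ext; rewrite /= E.
Qed.

Lemma cintegral_cons n (f : n.+1.-tuple rT -> C) : integrableC (muRn n.+1) f ->
  cintegral (muRn n.+1) f =
  cintegral muR (fun s => cintegral (muRn n) (fun u : n.-tuple rT => f [tuple of s :: u])).
Proof.
have E (u : n.+1.-tuple rT -> R) :
    (muRn n.+1).-integrable setT (fun x => (u x)%:E) ->
    (\int[muRn n.+1]_t u t = \int[muR]_s \int[muRn n]_v u [tuple of s :: v])%R.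
  move=> iu; have iu' := integrable_consR iu.
  rewrite {1}/Rintegral integral_consR; last first.
    exact/measurable_EFinP/measurable_int/iu.
  rewrite -(integral12_prod_meas1 iu') /Rintegral; congr fine.
  apply: ae_eq_integral => //.
  - exact: measurable_fubini_F iu'.
  - apply/measurable_EFinP; apply: measurableT_comp => //.
    exact: (measurable_fubini_F iu').
  apply: filterS (ae_integrable1 iu') => v iv _.
  rewrite fineK//; exact: integrable_fin_num iv.
by move=> [fr fi]; apply: complex_ext; rewrite /= E.
Qed.

End tuple_measure.

(** * Creation and annihilation in a fixed degree *)

Arguments comp {R} x n t.

(* No integrability assumption: [fine] sends both infinities to 0. *)
Lemma Rintegral_opp d (T : measurableType d) (R : realType)
    (m : {measure set T -> \bar R}) (f : T -> R) :
  (\int[m]_t (- f t) = - \int[m]_t f t)%R.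
Proof.
rewrite /Rintegral [X in fine X]integralE [X in - fine X]integralE.
have -> : (fun t => (- f t)%:E) = (\- (EFin \o f))%E by apply/funext.
rewrite funeposN funenegN.
have : (0 <= \int[m]_x (EFin \o f)^\+ x)%E by exact: integral_ge0.
have : (0 <= \int[m]_x (EFin \o f)^\- x)%E by exact: integral_ge0.
rewrite -![(fun t => (f t)%:E)]/(EFin \o f).
by case: (\int[m]_x _)%E => [a| |]; case: (\int[m]_x _)%E => [b| |] //= _ _;
  rewrite ?oppr0 ?opprB.
Qed.

Section creation_annihilation.
Context {R : realType}.
Local Notation rT := (measurableTypeR R).
Local Notation C := R[i].
Implicit Types (z w : rT -> C) (x y k : seq rT -> C).

(* Representatives of b^*(z) x and b(z) x, for x a sequence of functions of
   all degrees at once. *)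
Definition crf z x (s : seq rT) : C := (size s)%:R^-1 * ext z x s.

Definition anf z x (s : seq rT) : C :=
  (size s).+1%:R * L2ip muR z (fun t => x (t :: s)).

Lemma crf_tuple z x n (t : n.+1.-tuple rT) :
  crf z x t = n.+1%:R^-1 *
    \sum_(i < n.+1) (-1) ^+ i * ctensor z (comp x n) (tofront i t).
Proof.
rewrite /crf size_tuple extE; congr (_ * _); apply: eq_bigr => i _.
Qed.

Lemma anf_tuple z x n (u : n.-tuple rT) :
  anf z x u = n.+1%:R * L2ip muR z (fun t => x (t :: u)).
Proof. by rewrite /anf size_tuple. Qed.

Lemma crfP z (a : C) x y t :
  crf z (fun s => a * x s + y s) t = a * crf z x t + crf z y t.
Proof. by rewrite /crf extP mulrDr mulrCA. Qed.

Lemma extZ z (c : C) x t : ext z (fun v => c * x v) t = c * ext z x t.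
Proof.
elim: t x => [|a u IH] x /=; first by rewrite mulr0.
rewrite IH; ring.
Qed.

(** Both orders carry the same size prefactors, so the sign is that of [ext_comm]. *)
Lemma crf_crf z w x t : crf z (crf w x) t = - crf w (crf z x) t.
Proof.
have E z' w' : crf z' (crf w' x) t =
    (size t)%:R^-1 * ((size t).-1%:R^-1 * ext z' (ext w' x) t).
  rewrite /crf; case: t => [|a u]; first by rewrite /= !mulr0.
  congr (_ * _); rewrite [size _]/= [_.-1]/=.
  rewrite (@eq_ext _ z' _ (fun v => (size u)%:R^-1 * ext w' x v) (size u))//.
    exact: extZ.
  by move=> v ->.
by rewrite !E ext_comm !mulrN.
Qed.

Lemma L2fun_crf z x n : L2fun muR z -> L2fun (muRn n) (comp x n) ->
  L2fun (muRn n.+1) (comp (crf z x) n.+1).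
Proof.
move=> Lz Lx; rewrite (_ : comp _ _ = fun t => n.+1%:R^-1 *
    \sum_(i < n.+1) (-1) ^+ i * ctensor z (comp x n) (tofront i t)); last first.
  by apply/funext => t; exact: crf_tuple.
apply: L2funZ; apply: L2fun_sum => i _; apply: L2funZ.
exact/L2fun_tofront/L2fun_ctensor.
Qed.

Lemma comp_crf z x n : Lambda (comp x n) ->
  comp (crf z x) n.+1 = wedge (fun1 z) (comp x n).
Proof.
move=> [_ Ax]; apply/funext => t; rewrite wedge_fun1//; exact: crf_tuple.
Qed.

Lemma Lambda_crf z x n : L2fun muR z -> Lambda (comp x n) ->
  Lambda (comp (crf z x) n.+1).
Proof.
move=> Lz Lx; split; first exact: L2fun_crf (Lx.1).
by rewrite comp_crf// => s t; exact: antisym_antisym.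
Qed.

(** Positive and negative parts are treated separately by Tonelli, so slices that are not integrable
    do no harm. *)
Lemma measurable_Rintegral_consr n (f : n.+1.-tuple rT -> R) :
  measurable_fun setT f ->
  measurable_fun setT (fun u : n.-tuple rT => \int[muR]_s f [tuple of s :: u])%R.
Proof.
move=> mf; have mf' : measurable_fun setT (fun p : rT * n.-tuple rT => (f (consR p))%:E).
  by apply/measurable_EFinP; apply: (measurableT_comp mf); exact: measurable_consR.
apply: measurableT_comp => //.
under eq_fun do rewrite integralE.
apply: emeasurable_funB.
  rewrite (_ : (fun _ => _) = fun u : n.-tuple rT =>
      \int[muR]_s (fun p => (f (consR p))%:E)^\+ (s, u))%E.
    exact: (measurable_fun_fubini_tonelli_G _ (measurable_funepos mf')).
  apply/funext => u; apply: eq_integral => s _.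
  by rewrite (funepos_comp (EFin \o f \o @consR R n) (fun s => (s, u))).
rewrite (_ : (fun _ => _) = fun u : n.-tuple rT =>
    \int[muR]_s (fun p => (f (consR p))%:E)^\- (s, u))%E.
  exact: (measurable_fun_fubini_tonelli_G _ (measurable_funeneg mf')).
apply/funext => u; apply: eq_integral => s _.
by rewrite (funeneg_comp (EFin \o f \o @consR R n) (fun s => (s, u))).
Qed.

Lemma measurableC_cintegral_consr n (f : n.+1.-tuple rT -> C) : measurableC f ->
  measurableC (fun u : n.-tuple rT => cintegral muR (fun s => f [tuple of s :: u])).
Proof.
move=> [fr fi]; split; first exact: (measurable_Rintegral_consr fr).
exact: (measurable_Rintegral_consr fi).
Qed.

Lemma measurableC_anf z x n : measurableC z -> measurableC (comp x n.+1) ->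
  measurableC (comp (anf z x) n).
Proof.
move=> mz mx.
rewrite (_ : comp _ _ = fun u : n.-tuple rT => n.+1%:R * cintegral muR (fun s =>
  (fun t : n.+1.-tuple rT => conjc (z (thead t)) * comp x n.+1 t)
    [tuple of s :: u])); first last.
  by apply/funext => u; rewrite /comp anf_tuple.
  apply: measurableCM; first exact: measurableC_cst.
  apply: (measurableC_cintegral_consr (f := fun t =>
    conjc (z (thead t)) * comp x n.+1 t)); apply: measurableCM => //.
  apply: measurableC_conj; have [zr zi] := mz.
  by split; [apply: (measurableT_comp zr)|apply: (measurableT_comp zi)];
    exact: measurable_tnth.
Qed.

(** Cauchy-Schwarz on almost every slice, then Tonelli. Only membership in L2 is at stake: relative
    to the Fock norms this constant grows with the degree, and the uniform bound is [fsq_anf_le]. *)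
Lemma L2fun_anf z x n : L2fun muR z -> L2fun (muRn n.+1) (comp x n.+1) ->
  L2fun (muRn n) (comp (anf z x) n).
Proof.
move=> Lz Lx; have mx := L2fun_measurable Lx.
have ma := measurableC_anf (L2fun_measurable Lz) mx.
apply/L2funE; split=> //.
pose G (u : n.-tuple rT) := (\int[muR]_s (normc (comp x n.+1 [tuple of s :: u]) ^+ 2)%:E)%E.
have mG : measurable_fun setT G.
  apply: (measurable_fun_fubini_tonelli_G
    (fun p => (normc (comp x n.+1 (consR p)) ^+ 2)%:E)) => //.
    by apply: (measurableT_comp (measurable_normc2 mx)); exact: measurable_consR.
  by move=> t; exact: normc2_ge0.
have G0 u : (0 <= G u)%E by apply: integral_ge0 => s _; exact: normc2_ge0.
have c0 : (0 <= n.+1%:R ^+ 2 * sqnorm muR z :> R)%R.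
  by rewrite mulr_ge0 ?sqr_ge0 ?sqnorm_ge0.
apply: (@le_lt_trans _ _ (\int[muRn n]_u ((n.+1%:R ^+ 2 * sqnorm muR z)%:E * G u))%E).
  apply: ae_ge0_le_integral => //.
  - by move=> u _; exact: normc2_ge0.
  - exact: measurable_normc2.
  - by move=> u _; rewrite mule_ge0.
  - exact: emeasurable_funM.
  apply: filterS (L2fun_consr Lx) => u Lu _.
  rewrite /comp anf_tuple normcM2.
  have -> : normc (n.+1%:R : C) = n.+1%:R.
    by rewrite -(rmorph_nat (real_complex R)) /= expr0n addr0 sqrtr_sqr ger0_norm.
  have -> : G u = (sqnorm muR (fun s => comp x n.+1 [tuple of s :: u]))%:E.
    by rewrite -L2norm_sqrE// L2norm_sqr.
  rewrite -!EFinM lee_fin -[leRHS]mulrA; apply: (ler_wpM2l (sqr_ge0 _)).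
  exact: cauchy_schwarz.
rewrite ge0_integralZl_EFin// lte_mul_pinfty ?lee_fin//.
rewrite -(ge0_integral_consC (measurable_normc2 mx) (fun t => normc2_ge0 _)).
by case/L2funE: Lx.
Qed.

(** [Lambda] asks for antisymmetry at every tuple, including those whose slice is not integrable.
    The sign therefore leaves the integral through [Rintegral_opp] and not through linearity. *)
Lemma Lambda_anf z x n : L2fun muR z -> Lambda (comp x n.+1) ->
  Lambda (comp (anf z x) n).
Proof.
move=> Lz [Lx Ax]; split; first exact: L2fun_anf.
move=> s u; rewrite /comp !anf_tuple mulrCA; congr (_ * _).
have E v : x (v :: permt s u) = (-1) ^+ s * x (v :: u).
  have := Ax (lift_perm ord0 ord0 s) [tuple of v :: u].
  rewrite odd_lift_perm /= /comp => <-; congr x.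
  rewrite (_ : permt _ _ = [tuple of v :: permt s u])//.
  apply: eq_from_tnth => i; rewrite tnth_mktuple.
  case: (unliftP ord0 i) => [j ->|->]; last by rewrite lift_perm_id.
  by rewrite lift_perm_lift !tnth_cons tnth_mktuple.
have S (b : bool) (c : C) : (-1) ^+ b * c = if b then - c else c.
  by case: b; rewrite ?expr1 ?expr0 ?mulN1r ?mul1r.
rewrite S /L2ip /cintegral.
under eq_Rintegral do rewrite E mulrCA S.
under [in X in _ +i* X]eq_Rintegral do rewrite E mulrCA S.
case: (odd_perm s) => //.
have RN (c : C) : complex.Re (- c) = - complex.Re c by case: c.
have IN (c : C) : complex.Im (- c) = - complex.Im c by case: c.
under eq_Rintegral do rewrite RN.
under [in X in _ +i* X]eq_Rintegral do rewrite IN.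
by rewrite !Rintegral_opp.
Qed.

(** By antisymmetry of [k], the sign of the i-th term of the wedge product is absorbed when variable
    i is moved to the front. All n+1 terms then have the same integral, that of [H], which cancels
    the factor 1/(n+1); Fubini with the front variable innermost produces the integral in [anf]. *)
Lemma crf_anf_adjoint z x k n : L2fun muR z -> L2fun (muRn n) (comp x n) ->
  Lambda (comp k n.+1) ->
  n.+1%:R * L2ip (muRn n.+1) (comp (crf z x) n.+1) (comp k n.+1) =
  L2ip (muRn n) (comp x n) (comp (anf z k) n).
Proof.
move=> Lz Lx [Lk Ak].
pose H (t : n.+1.-tuple rT) := conjc (ctensor z (comp x n) t) * comp k n.+1 t.
have IH : integrableC (muRn n.+1) H.
  by apply: L2funM => //; exact/L2fun_conj/L2fun_ctensor.
have conj_sum (F : 'I_n.+1 -> C) : conjc (\sum_i F i) = \sum_i conjc (F i).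
  by apply: (big_morph conjc (@conjcD R)); rewrite conjc0.
have conj_sign i : conjc ((-1) ^+ i : C) = (-1) ^+ i.
  rewrite -signr_odd; case: odd; rewrite ?expr1 ?expr0 ?conjc1//.
  by apply: complex_ext; rewrite /= ?oppr0.
have -> : L2ip (muRn n.+1) (comp (crf z x) n.+1) (comp k n.+1) = cintegral (muRn n.+1) H.
  transitivity (cintegral (muRn n.+1) (fun t => n.+1%:R^-1 * \sum_(i < n.+1) H (tofront i t))).
    apply: eq_cintegral => t; rewrite /comp crf_tuple conjcM conjc_inv conjc_nat -mulrA.
    congr (_ * _); rewrite conj_sum mulr_suml; apply: eq_bigr => i _.
    rewrite conjcM conj_sign /H -mulrA mulrCA; congr (_ * _).
    by rewrite tofrontE Ak odd_lift_perm odd_perm1 addbF signr_odd.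
  rewrite cintegralZ; last first.
    by apply: integrableC_sum => i _; exact: integrableC_tofront.
  rewrite cintegral_sum; last by move=> i _; exact: integrableC_tofront.
  have mH : measurableC H.
    apply: measurableCM; last exact: L2fun_measurable Lk.
    by apply/measurableC_conj/L2fun_measurable/L2fun_ctensor.
  under eq_bigr do rewrite cintegral_tofront//.
  rewrite sumr_const card_ord -[X in _ * X]mulr_natl mulrA mulVf ?mul1r//.
have IG : integrableC (muRn n) (fun u => conjc (comp x n u) * comp (anf z k) n u).
  by apply: L2funM; [exact: L2fun_conj|exact: L2fun_anf].
have n0 : n.+1%:R != 0 :> C by rewrite pnatr_eq0.
rewrite cintegral_consC// /L2ip -[RHS](mulVKf n0).
congr (_ * _); rewrite -cintegralZ//; apply: ae_cintegral.
- apply: measurableC_cintegral_consr; apply: measurableCM; last exact: L2fun_measurable Lk.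
  by apply/measurableC_conj/L2fun_measurable/L2fun_ctensor.
- apply: measurableCM; [exact: measurableC_cst|apply: measurableCM].
  + exact/measurableC_conj/(L2fun_measurable Lx).
  + exact: (L2fun_measurable (L2fun_anf Lz Lk)).
apply: filterS (L2fun_consr Lk) => u Lu _.
rewrite {2}/comp anf_tuple mulrCA (mulKf n0).
rewrite /L2ip -cintegralZ; last by apply: L2funM => //; exact: L2fun_conj.
apply: eq_cintegral => s.
by rewrite /H /ctensor theadE behead_cons conjcM mulrCA mulrA.
Qed.

Lemma L2ipZ d (T : measurableType d) (m : {measure set T -> \bar R}) f (c : C) g :
  L2fun m f -> L2fun m g -> L2ip m f (fun t => c * g t) = c * L2ip m f g.
Proof.
move=> Lf Lg; have := L2ipP c Lf Lg (L2fun0 m).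
under eq_fun do rewrite addr0.
move=> ->; rewrite /L2ip; under [cintegral _ (fun=> _ * 0)]eq_cintegral do rewrite mulr0.
by rewrite cintegral0 addr0.
Qed.

Lemma L2ip_sum d (T : measurableType d) (m : {measure set T -> \bar R})
    I (r : seq I) (P : pred I) f (F : I -> T -> C) :
  L2fun m f -> (forall i, P i -> L2fun m (F i)) ->
  L2ip m f (fun t => \sum_(i <- r | P i) F i t) = \sum_(i <- r | P i) L2ip m f (F i).
Proof.
move=> Lf LF; rewrite /L2ip; under eq_cintegral do rewrite mulr_sumr.
by apply: cintegral_sum => i Pi; apply: L2funM; [exact: L2fun_conj|exact: LF].
Qed.

(** The canonical anticommutation relation. In b(z) b^*(w) x, the term where [w] receives the
    integrated variable gives <z, w> x; those where it receives entry i of [u] cancel b^*(w) b(z) x.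
    The exceptional set is a finite union of null sets, one for each deleted entry. *)
Lemma anf_crf z w x n : L2fun muR z -> L2fun muR w -> L2fun (muRn n) (comp x n) ->
  {ae muRn n, forall u : n.-tuple rT,
    anf z (crf w x) u + crf w (anf z x) u = L2ip muR z w * x u}.
Proof.
move=> Lz Lw Lx.
have E (u : n.-tuple rT) : L2fun muR (fun t => ext w (fun v => x (t :: v)) u) ->
    anf z (crf w x) u = L2ip muR z w * x u -
      L2ip muR z (fun t => ext w (fun v => x (t :: v)) u).
  move=> Le; rewrite anf_tuple.
  rewrite (_ : (fun t => _) = fun t => n.+1%:R^-1 *
      (x u * w t + (- 1) * ext w (fun v => x (t :: v)) u)); last first.
    by apply/funext => t; rewrite /crf /= size_tuple mulN1r [w t * _]mulrC.
  rewrite L2ipZ//; last by apply: L2funP => //; exact: L2funZ.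
  rewrite mulrA mulfV ?pnatr_eq0// mul1r L2ipP//; last exact: L2funZ.
  by rewrite L2ipZ// mulN1r mulrC.
case: n => [|n] in x Lx E *.
  apply: aeW => u; have -> : u = [tuple] by exact: tuple0.
  rewrite E /=; last exact: L2fun0.
  rewrite /crf /= mulr0 addr0 /L2ip.
  by under [X in _ - X]eq_cintegral do rewrite mulr0; rewrite cintegral0 subr0.
have : {ae muRn n.+1, forall u : n.+1.-tuple rT, forall i : 'I_n.+1,
    L2fun muR (fun s => x (s :: deltuple u i))}.
  by apply: filter_forall => i; apply: (ae_deltuple i
    (P := fun v : n.-tuple rT => L2fun muR (fun s => x (s :: v)))); exact: L2fun_consr Lx.
apply: filterS => u Lu.
have eE : (fun t => ext w (fun v => x (t :: v)) u) = fun t =>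
   \sum_(i < n.+1) (-1) ^+ i * w (tnth u i) * x (t :: deltuple u i).
  by apply/funext => t; rewrite extE; apply: eq_bigr => i _; rewrite mulrA.
rewrite E; last by rewrite eE; apply: L2fun_sum => i _; exact: L2funZ.
rewrite /crf size_tuple extE eE L2ip_sum//; last by move=> i _; exact: L2funZ.
rewrite -[RHS]addr0 -addrA; congr (_ + _); rewrite addrC mulr_sumr -sumrB.
rewrite big1// => i _; rewrite L2ipZ// anf_tuple.
rewrite !mulrA [_ * _ * n.+1%:R]mulrC.
by rewrite !mulrA mulfV ?pnatr_eq0// mul1r subrr.
Qed.

End creation_annihilation.

(** * Series of real numbers *)

Section series.
Context {R : realType}.
Implicit Types u : nat -> R.

Lemma ge0_series_cvg u (M : R) : (forall n, 0 <= u n) ->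
  (forall N, \sum_(0 <= n < N) u n <= M) -> cvgn (series u).
Proof.
move=> u0 uM; apply: nondecreasing_is_cvgn; first exact: nondecreasing_series.
by exists M => _ [N _ <-]; exact: uM.
Qed.

(** Turns the summability condition of [prefock_pred] into bounded partial sums, to which estimates
    made degree by degree apply. *)
Lemma nneseries_fin_numP u : (forall n, 0 <= u n) ->
  (\sum_(0 <= n <oo) (u n)%:E < +oo)%E <->
  exists M, forall N, \sum_(0 <= n < N) u n <= M.
Proof.
move=> u0; split=> [foo|[M uM]].
  have S0 : (0 <= \sum_(0 <= n <oo) (u n)%:E)%E.
    by apply: nneseries_ge0 => n _ _; rewrite lee_fin.
  exists (fine (\sum_(0 <= n <oo) (u n)%:E)%E) => N.
  rewrite -lee_fin fineK ?ge0_fin_numE// -sumEFin.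
  by apply: nneseries_lim_ge => n _ _; rewrite lee_fin.
apply: (@le_lt_trans _ _ M%:E); last exact: ltry.
apply: lime_le; first by apply: is_cvg_nneseries => n _ _; rewrite lee_fin.
by near=> N; rewrite sumEFin lee_fin; exact: uM.
Unshelve. all: by end_near. Qed.

Lemma ge0_series_lim_le u (M : R) : (forall n, 0 <= u n) ->
  (forall N, \sum_(0 <= n < N) u n <= M) -> limn (series u) <= M.
Proof.
move=> u0 uM; apply: limr_le; first exact: ge0_series_cvg uM.
by apply: nearW => N; exact: uM.
Qed.

Lemma ge0_series_le_lim u (M : R) N : (forall n, 0 <= u n) ->
  (forall N, \sum_(0 <= n < N) u n <= M) ->
  \sum_(0 <= n < N) u n <= limn (series u).
Proof.
move=> u0 uM; apply: (nondecreasing_cvgn_le (u_ := series u)).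
  exact: nondecreasing_series.
exact: ge0_series_cvg uM.
Qed.

Lemma lim_series_single u m : (forall n, n != m -> u n = 0) ->
  limn (series u) = u m.
Proof.
move=> um; apply: lim_near_cst => //.
near=> N; rewrite /series /= (bigD1_seq m) ?iota_uniq//=.
  by rewrite big1_seq ?addr0// => n /andP[nm _]; exact: um.
by rewrite mem_index_iota; near: N; exact: nbhs_infty_gt.
Unshelve. all: by end_near. Qed.

(** No convergence is assumed: both series have the same set of limits, from which [lim] makes the
    same choice. This lets [an_adjoint] compare inner products without proving that they
    converge. *)
Lemma lim_series_shift u : u 0%N = 0 -> limn (series u) = limn (series (fun n => u n.+1)).
Proof.
move=> u0; rewrite -[RHS]/(lim _) /lim /lim_in; congr get; apply/funext => l.
apply/propext; rewrite -(cvg_shiftS (series u)).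
rewrite (_ : (fun n => series u n.+1) = series (fun n => u n.+1))//.
by apply/funext => n; rewrite /series /= big_nat_recl// u0 add0r.
Qed.

End series.

(** * Adjointness and norm estimates in each degree *)

Section degree_norms.
Context {R : realType}.
Local Notation rT := (measurableTypeR R).
Local Notation C := R[i].
Implicit Types (z w : rT -> C) (x y k : seq rT -> C).

Definition fip n x y : C := n`!%:R * L2ip (muRn n) (comp x n) (comp y n).

Definition fsq n x : R := n`!%:R * sqnorm (muRn n) (comp x n).

Lemma fip_fsq n x : fip n x x = (fsq n x)%:C.
Proof. by rewrite /fip L2ip_sqnorm rmorphM /= rmorph_nat. Qed.

Lemma fsq_ge0 n x : 0 <= fsq n x.
Proof. by rewrite mulr_ge0// sqnorm_ge0. Qed.

Lemma fip_adjoint z x k n : L2fun muR z -> L2fun (muRn n) (comp x n) ->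
  Lambda (comp k n.+1) -> fip n.+1 (crf z x) k = fip n x (anf z k).
Proof.
move=> Lz Lx Lk; rewrite /fip -crf_anf_adjoint// mulrA; congr (_ * _).
by rewrite factS natrM mulrC.
Qed.

Lemma fipC n x y : L2fun (muRn n) (comp x n) -> L2fun (muRn n) (comp y n) ->
  fip n y x = conjc (fip n x y).
Proof. by move=> Lx Ly; rewrite /fip L2ipC// conjcM conjc_nat. Qed.

Lemma fipDr n x y y' : L2fun (muRn n) (comp x n) -> L2fun (muRn n) (comp y n) ->
  L2fun (muRn n) (comp y' n) ->
  fip n x (fun s => y s + y' s) = fip n x y + fip n x y'.
Proof.
move=> Lx Ly Ly'; rewrite /fip -mulrDr -[X in X + _]mul1r -L2ipP//.
by congr (_ * L2ip _ _ _); apply/funext => t; rewrite mul1r.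
Qed.

Lemma comp_crf0 z x : comp (crf z x) 0 = fun=> 0.
Proof. by apply/funext => t; rewrite /comp tuple0 /crf /= mulr0. Qed.

Lemma L2fun_crf_pred z x n : L2fun muR z ->
  (forall m, m.+1 = n -> L2fun (muRn m) (comp x m)) ->
  L2fun (muRn n) (comp (crf z x) n).
Proof.
case: n => [|n] Lz Lx; last exact/L2fun_crf/Lx.
by rewrite comp_crf0; exact: L2fun0.
Qed.

(** One [crf] is moved across the inner product as an [anf]; the sum then collapses by [anf_crf]
    with w = z. *)
Lemma fip_crf z x n : L2fun muR z -> Lambda (comp x n) ->
  (fsq n.+1 (crf z x))%:C + fip n x (crf z (anf z x)) = (sqnorm muR z * fsq n x)%:C.
Proof.
move=> Lz Lx; have [L2x _] := Lx.
have Lc := Lambda_crf Lz Lx.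
have Lac := L2fun_anf Lz Lc.1.
have Lca : L2fun (muRn n) (comp (crf z (anf z x)) n).
  by apply: L2fun_crf_pred => // m mn; apply: L2fun_anf; rewrite // mn.
rewrite -fip_fsq fip_adjoint// -fipDr// rmorphM /= -fip_fsq -L2ip_sqnorm /fip.
rewrite mulrCA; congr (_ * _); rewrite -L2ipZ//; apply: ae_L2ip => //.
- by have := L2funP 1 Lac Lca; under eq_fun do rewrite mul1r.
- exact: L2funZ.
- exact: aeW.
by apply: filterS (anf_crf Lz Lz L2x) => u e _; exact: e.
Qed.

Lemma fsq_crf0 z x : L2fun muR z -> Lambda (comp x 0) ->
  fsq 1 (crf z x) = sqnorm muR z * fsq 0 x.
Proof.
move=> Lz Lx; apply: complexI; rewrite -fip_crf//.
rewrite [X in _ + X](_ : _ = 0) ?addr0// /fip comp_crf0 /L2ip.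
by under eq_cintegral do rewrite mulr0; rewrite cintegral0 mulr0.
Qed.

(** A second use of adjointness turns the remaining inner product of [fip_crf] into a squared norm.
    Both summands being nonnegative, each operator has norm at most |z| in every degree. *)
Lemma fsq_crf_anf z x n : L2fun muR z -> Lambda (comp x n.+1) ->
  fsq n.+2 (crf z x) + fsq n (anf z x) = sqnorm muR z * fsq n.+1 x.
Proof.
move=> Lz Lx; apply: complexI; rewrite -fip_crf// rmorphD /=; congr (_ + _).
have La := Lambda_anf Lz Lx.
have Lc := L2fun_crf Lz La.1.
rewrite (fipC Lc Lx.1) fip_adjoint//; last exact: La.1.
by rewrite fip_fsq; apply: complex_ext; rewrite /= ?oppr0.
Qed.

Lemma fsq_crf_le z x n : L2fun muR z -> Lambda (comp x n) ->
  fsq n.+1 (crf z x) <= sqnorm muR z * fsq n x.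
Proof.
case: n => [|n] Lz Lx; first by rewrite fsq_crf0.
by rewrite -fsq_crf_anf// lerDl fsq_ge0.
Qed.

Lemma fsq_anf_le z x n : L2fun muR z -> Lambda (comp x n.+1) ->
  fsq n (anf z x) <= sqnorm muR z * fsq n.+1 x.
Proof. by move=> Lz Lx; rewrite -fsq_crf_anf// lerDr fsq_ge0. Qed.

Lemma fsqP n (a : C) x y : L2fun (muRn n) (comp x n) -> L2fun (muRn n) (comp y n) ->
  fsq n (fun s => a * x s + y s) <= 2 * normc a ^+ 2 * fsq n x + 2 * fsq n y.
Proof.
move=> Lx Ly; rewrite /fsq mulrCA [X in _ + X]mulrCA -mulrDr; apply: ler_wpM2l => //.
rewrite -lee_fin EFinD !EFinM -!L2norm_sqrE//.
  rewrite -!EFinM; exact: L2norm_sqrP.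
exact: L2funP.
Qed.

(** Makes creation well defined on classes: a null set of n-tuples pulls back to a null set under
    each of the n+1 deletions. *)
Lemma ae_crf z x y n : comp x n = comp y n %[ae muRn n] ->
  comp (crf z x) n.+1 = comp (crf z y) n.+1 %[ae muRn n.+1].
Proof.
move=> xy.
have : {ae muRn n.+1, forall t : n.+1.-tuple rT, forall i : 'I_n.+1,
    x (deltuple t i) = y (deltuple t i)}.
  apply: filter_forall => i; apply: (ae_deltuple i
    (P := fun v : n.-tuple rT => x v = y v)).
  by apply: filterS xy => v; exact.
apply: filterS => t xyt _; rewrite /comp /crf !extE; congr (_ * _).
by apply: eq_bigr => i _; rewrite xyt.
Qed.

Lemma ae_anf z x y n : L2fun muR z ->
  L2fun (muRn n.+1) (comp x n.+1) -> L2fun (muRn n.+1) (comp y n.+1) ->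
  comp x n.+1 = comp y n.+1 %[ae muRn n.+1] ->
  comp (anf z x) n = comp (anf z y) n %[ae muRn n].
Proof.
move=> Lz Lx Ly xy.
have := ae_consr (P := fun t : n.+1.-tuple rT => x t = y t).
move=> /(_ _)/wrap[|xyu].
  by apply: filterS xy => v; exact.
move: (L2fun_consr Lx) (L2fun_consr Ly) xyu.
apply: filterS3 => u Lxu Lyu xyu _.
rewrite /comp !anf_tuple; congr (_ * _); apply: ae_L2ip => //.
- exact: aeW.
by apply: filterS xyu => s e _; exact: e.
Qed.

Lemma anfP z (a : C) x y n : L2fun muR z ->
  L2fun (muRn n.+1) (comp x n.+1) -> L2fun (muRn n.+1) (comp y n.+1) ->
  comp (anf z (fun s => a * x s + y s)) n =
  (fun u => a * comp (anf z x) n u + comp (anf z y) n u) %[ae muRn n].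
Proof.
move=> Lz Lx Ly; move: (L2fun_consr Lx) (L2fun_consr Ly).
apply: filterS2 => u Lxu Lyu _.
by rewrite /comp !anf_tuple L2ipP// mulrDr mulrCA.
Qed.

End degree_norms.

(** * The Fock space *)

Local Open Scope quotient_scope.

Section fock_space.
Context {R : realType}.
Local Notation rT := (measurableTypeR R).
Local Notation C := R[i].
Local Notation fock := (fock R).
Local Notation prefock := (@prefock R).
Implicit Types (z w : rT -> C) (f g : seq rT -> C) (x y : fock).

Lemma L2norm_fsq n f : L2fun (muRn n) (comp f n) ->
  (n`!%:R%:E * L2norm (muRn n) (comp f n) ^+ 2 = (fsq n f)%:E)%E.
Proof. by move=> Lf; rewrite L2norm_sqrE// -EFinM. Qed.

Lemma prefockP f : f \in prefock_pred <->
  (forall n, Lambda (comp f n)) /\ exists M, forall N, \sum_(0 <= n < N) fsq n f <= M.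
Proof.
have E : (forall n, Lambda (comp f n)) ->
    (\sum_(0 <= n <oo) n`!%:R%:E * L2norm (muRn n) (comp f n) ^+ 2 =
     \sum_(0 <= n <oo) (fsq n f)%:E)%E.
  by move=> Lf; apply: eq_eseriesr => n _; exact: L2norm_fsq (Lf n).1.
have P := nneseries_fin_numP (u := fun n => fsq n f) (fun n => fsq_ge0 n f).
split=> [/asboolP[Lf]|[Lf]].
  by rewrite E// => /P fM; split.
by move=> /P fM; apply/asboolP; split=> //; rewrite E.
Qed.

Lemma fock_eqP (p q : prefock) :
  \pi_fock p = \pi_fock q <-> forall n, comp p n = comp q n %[ae muRn n].
Proof.
split=> [/eqP|pq]; last apply/eqP; rewrite -Quotient.idealrBE.
  move=> /asboolP pq n; apply: filterS (pq n) => t pqt _; apply/eqP.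
  by rewrite -subr_eq0; apply/eqP; exact: pqt.
apply/asboolP => n; apply: filterS (pq n) => t pqt _.
by rewrite -[LHS]/(comp p n t - comp q n t) pqt// subrr.
Qed.

(** [fock_ip] and the operators below go through [repr], an arbitrary choice in each class; this
    relation allows computing with any convenient family instead. *)
Definition represents x f := f \in prefock_pred /\
  forall n, comp (repr x) n = comp f n %[ae muRn n].

Lemma represents_pi (p : prefock) : represents (\pi_fock p) p.
Proof. by split; [exact: valP|apply/fock_eqP; rewrite reprK]. Qed.

Lemma represents_repr x : represents x (repr x).
Proof. by split; [exact: valP|move=> n; exact: aeW]. Qed.

Lemma represents_inj x y f g : represents x f -> represents y g ->
  (forall n, comp f n = comp g n %[ae muRn n]) -> x = y.
Proof.
move=> [_ xf] [_ yg] fg; rewrite -[x]reprK -[y]reprK; apply/fock_eqP => n.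
by move: (xf n) (yg n) (fg n); apply: filterS3 => t e1 e2 e3 _; rewrite e1// e2// e3.
Qed.

Lemma represents_Lambda x f n : represents x f -> Lambda (comp f n).
Proof. by move=> [/prefockP[Lf _] _]. Qed.

Lemma represents_L2 x f n : represents x f -> L2fun (muRn n) (comp f n).
Proof. by move=> xf; exact: (represents_Lambda n xf).1. Qed.

Lemma represents_transfer x (p : prefock) f : represents x p -> f \in prefock_pred ->
  (forall n, comp p n = comp f n %[ae muRn n]) -> represents x f.
Proof.
move=> [_ xp] Pf pf; split=> // n.
by move: (xp n) (pf n); apply: filterS2 => t e1 e2 _; rewrite e1// e2.
Qed.

Lemma representsP (a : C) x y f g : represents x f -> represents y g ->
  represents (a *: x + y) (fun s => a * f s + g s).
Proof.
move=> [Pf xf] [Pg yg].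
apply: (@represents_transfer _ (a *: repr x + repr y)).
- rewrite (_ : a *: x + y = \pi_fock (a *: repr x + repr y)); first exact: represents_pi.
  by rewrite raddfD /= reprK.
- by have [_ H] := @prefock_submod R; exact: H.
move=> n; move: (xf n) (yg n); apply: filterS2 => t e1 e2 _.
rewrite -[LHS]/(a * comp (repr x) n t + comp (repr y) n t).
by rewrite e1// e2.
Qed.

Lemma represents0 : represents 0 (fun=> 0).
Proof.
have := represents_pi 0; rewrite raddf0 => H; apply: represents_transfer H _ _.
  by have [H _] := @prefock_submod R.
by move=> n; apply: aeW.
Qed.

Lemma fip_represents n x y f g : represents x f -> represents y g ->
  fip n (repr x) (repr y) = fip n f g.
Proof.
move=> xf yg; congr (_ * _); apply: ae_L2ip.
- exact: represents_L2 (represents_repr x).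
- exact: represents_L2 (represents_repr y).
- exact: represents_L2 xf.
- exact: represents_L2 yg.
- exact: xf.2.
- exact: yg.2.
Qed.

Lemma fock_ipE x y f g : represents x f -> represents y g ->
  fock_ip x y = limn (series (fun n => complex.Re (fip n f g))) +i*
                limn (series (fun n => complex.Im (fip n f g))).
Proof.
move=> xf yg; rewrite /fock_ip.
congr (limn (series _) +i* limn (series _)); apply/funext => n;
  by rewrite -(fip_represents n xf yg).
Qed.

Definition total f : R := limn (series (fun n => fsq n f)).

Lemma total_le f M : (forall N, \sum_(0 <= n < N) fsq n f <= M) -> total f <= M.
Proof. by move=> fM; apply: ge0_series_lim_le => // n; exact: fsq_ge0. Qed.

Lemma series_le_total f N : f \in prefock_pred -> \sum_(0 <= n < N) fsq n f <= total f.
Proof.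
move=> /prefockP[_ [M fM]]; apply: ge0_series_le_lim fM => n; exact: fsq_ge0.
Qed.

Lemma total_ge0 f : f \in prefock_pred -> 0 <= total f.
Proof. by move=> /(series_le_total 0); rewrite big_geq. Qed.

Lemma fock_normE x f : represents x f -> fock_norm x = Num.sqrt (total f).
Proof.
move=> xf; rewrite /fock_norm (fock_ipE xf xf) /=; congr (Num.sqrt (limn (series _))).
by apply/funext => n; rewrite fip_fsq.
Qed.

Lemma fock_norm_le x y f g (M : R) : represents x f -> represents y g -> 0 <= M ->
  total f <= M * total g -> fock_norm x <= Num.sqrt M * fock_norm y.
Proof.
move=> xf yg M0 fg; rewrite (fock_normE xf) (fock_normE yg) -sqrtrM//.
by rewrite ler_sqrt// mulr_ge0// total_ge0//; case: yg.
Qed.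

Lemma fock_norm_ge0 x : 0 <= fock_norm x.
Proof. exact: sqrtr_ge0. Qed.

Lemma fock_norm_eq0 x : fock_norm x = 0 -> x = 0.
Proof.
have xr := represents_repr x; rewrite (fock_normE xr) => /eqP.
rewrite sqrtr_eq0 => t0.
apply: (represents_inj xr represents0) => n.
apply: sqnorm_eq0; first exact: represents_L2 xr.
have := series_le_total n.+1 xr.1; rewrite big_nat_recr//= => /le_trans/(_ t0).
have S0 : 0 <= \sum_(0 <= i < n) fsq i (repr x) by apply: sumr_ge0 => i _; exact: fsq_ge0.
move=> H; have : fsq n (repr x) <= 0 by apply: le_trans H; rewrite lerDr.
rewrite /fsq pmulr_rle0 ?ltr0n ?fact_gt0// => H'.
by apply/eqP; rewrite eq_le H' sqnorm_ge0.
Qed.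

(** The factor 2 is harmless where only boundedness is asked for, and it spares a Cauchy-Schwarz
    inequality for the Fock inner product. *)
Lemma fock_normD x y : fock_norm (x + y) <= 2 * (fock_norm x + fock_norm y).
Proof.
have xr := represents_repr x; have yr := represents_repr y.
have := representsP 1 xr yr; rewrite scale1r => xyr.
have tx := total_ge0 xr.1; have ty := total_ge0 yr.1.
rewrite (fock_normE xyr) (fock_normE xr) (fock_normE yr).
set a := Num.sqrt (total (repr x)); set b := Num.sqrt (total (repr y)).
have a2 : total (repr x) = a ^+ 2 by rewrite sqr_sqrtr.
have b2 : total (repr y) = b ^+ 2 by rewrite sqr_sqrtr.
have a0 : 0 <= a by exact: sqrtr_ge0.
have b0 : 0 <= b by exact: sqrtr_ge0.
have : total (fun s => 1 * repr x s + repr y s) <= 2 * a ^+ 2 + 2 * b ^+ 2.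
  rewrite -a2 -b2; apply: total_le => N.
  apply: (@le_trans _ _ (2 * (\sum_(0 <= n < N) fsq n (repr x)) +
      2 * (\sum_(0 <= n < N) fsq n (repr y)))).
    rewrite !mulr_sumr -big_split/=; apply: ler_sum => n _.
    have := fsqP 1 (represents_L2 n xr) (represents_L2 n yr).
    by rewrite ComplexField.Normc.normc1 expr1n mulr1.
  by apply: lerD; apply: ler_wpM2l => //; apply: series_le_total; case: xr; case: yr.
move=> H; rewrite -[leRHS](@ger0_norm _ (2 * (a + b))); last first.
  by rewrite mulr_ge0// addr_ge0.
rewrite -sqrtr_sqr; apply: ler_wsqrtr; apply: le_trans H _; nra.
Qed.

(** [insubd 0] makes the operator total in [z]; for [z] in L2 the default is never reached, by
    [crf_prefock]. *)
Definition cr z x : fock := \pi_fock (insubd 0 (crf z (repr x))).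
Definition an z x : fock := \pi_fock (insubd 0 (anf z (repr x))).

Lemma fsq_eq0 n f : comp f n = (fun=> 0) -> fsq n f = 0.
Proof.
move=> f0; rewrite /fsq f0 (_ : sqnorm _ _ = 0) ?mulr0//.
apply: complexI; rewrite -L2ip_sqnorm /L2ip.
by under eq_cintegral do rewrite mulr0; rewrite cintegral0.
Qed.

Lemma crf_prefock_le z f N : L2fun muR z -> f \in prefock_pred ->
  \sum_(0 <= n < N) fsq n (crf z f) <= sqnorm muR z * total f.
Proof.
move=> Lz Pf; have /prefockP[Lf _] := Pf.
case: N => [|N].
  by rewrite big_geq// mulr_ge0 ?sqnorm_ge0 ?total_ge0.
rewrite big_nat_recl// fsq_eq0 ?add0r; last exact: comp_crf0.
apply: (@le_trans _ _ (sqnorm muR z * \sum_(0 <= n < N) fsq n f)).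
  by rewrite mulr_sumr; apply: ler_sum => n _; exact: fsq_crf_le.
by apply: ler_wpM2l; [exact: sqnorm_ge0|exact: series_le_total].
Qed.

Lemma anf_prefock_le z f N : L2fun muR z -> f \in prefock_pred ->
  \sum_(0 <= n < N) fsq n (anf z f) <= sqnorm muR z * total f.
Proof.
move=> Lz Pf; have /prefockP[Lf _] := Pf.
(* Annihilation lowers the degree, so N components of the image involve N+1 components of [f]. *)
apply: (@le_trans _ _ (sqnorm muR z * \sum_(0 <= n < N.+1) fsq n f)); last first.
  by apply: ler_wpM2l; [exact: sqnorm_ge0|exact: series_le_total].
rewrite big_nat_recl// mulrDr mulr_sumr.
apply: (@le_trans _ _ (\sum_(0 <= n < N) sqnorm muR z * fsq n.+1 f)).
  by apply: ler_sum => n _; exact: fsq_anf_le.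
by rewrite lerDr mulr_ge0 ?sqnorm_ge0 ?fsq_ge0.
Qed.

Lemma Lambda0 n : @Lambda R n (fun=> 0).
Proof. by split=> [|s t]; [exact: L2fun0|rewrite mulr0]. Qed.

Lemma crf_prefock z f : L2fun muR z -> f \in prefock_pred -> crf z f \in prefock_pred.
Proof.
move=> Lz Pf; apply/prefockP; split; last first.
  by exists (sqnorm muR z * total f) => N; exact: crf_prefock_le.
have /prefockP[Lf _] := Pf.
by case=> [|n]; [rewrite comp_crf0; exact: Lambda0|exact: Lambda_crf].
Qed.

Lemma anf_prefock z f : L2fun muR z -> f \in prefock_pred -> anf z f \in prefock_pred.
Proof.
move=> Lz Pf; apply/prefockP; split; last first.
  by exists (sqnorm muR z * total f) => N; exact: anf_prefock_le.
by have /prefockP[Lf _] := Pf => n; exact: Lambda_anf.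
Qed.

Lemma represents_cr z x f : L2fun muR z -> represents x f ->
  represents (cr z x) (crf z f).
Proof.
move=> Lz [Pf xf]; have Px := crf_prefock Lz (valP (repr x)).
apply: represents_transfer (represents_pi _) (crf_prefock Lz Pf) _ => n.
rewrite insubdK//; case: n => [|n]; first by rewrite !comp_crf0; exact: aeW.
exact: ae_crf.
Qed.

Lemma represents_an z x f : L2fun muR z -> represents x f ->
  represents (an z x) (anf z f).
Proof.
move=> Lz xf; have [Pf xf'] := xf; have Px := anf_prefock Lz (valP (repr x)).
apply: represents_transfer (represents_pi _) (anf_prefock Lz Pf) _ => n.
rewrite insubdK//; apply: ae_anf => //.
  exact: represents_L2 (represents_repr x).
exact: represents_L2 xf.
Qed.

Lemma represents_in_degree n (w : n.-tuple rT -> C) : Lambda w ->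
  represents (in_degree w) (extend0 w).
Proof.
move=> Lw; have := represents_pi (insubd 0 (extend0 w)).
by rewrite insubdK//; exact: extend0_prefock.
Qed.

Lemma cr_bounded z : L2fun muR z -> is_bounded (cr z).
Proof.
move=> Lz; split.
  move=> a x y; have xr := represents_repr x; have yr := represents_repr y.
  apply: (represents_inj (represents_cr Lz (representsP a xr yr))
    (representsP a (represents_cr Lz xr) (represents_cr Lz yr))) => n.
  by apply: aeW => t _; rewrite /comp crfP.
exists (Num.sqrt (sqnorm muR z)) => x; have xr := represents_repr x.
apply: (fock_norm_le (represents_cr Lz xr) xr); first exact: sqnorm_ge0.
by apply: total_le => N; apply: crf_prefock_le => //; case: xr.
Qed.

Lemma an_bounded z : L2fun muR z -> is_bounded (an z).
Proof.
move=> Lz; split.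
  move=> a x y; have xr := represents_repr x; have yr := represents_repr y.
  apply: (represents_inj (represents_an Lz (representsP a xr yr))
    (representsP a (represents_an Lz xr) (represents_an Lz yr))) => n.
  by apply: anfP => //; [exact: represents_L2 xr|exact: represents_L2 yr].
exists (Num.sqrt (sqnorm muR z)) => x; have xr := represents_repr x.
apply: (fock_norm_le (represents_an Lz xr) xr); first exact: sqnorm_ge0.
by apply: total_le => N; apply: anf_prefock_le => //; case: xr.
Qed.

Lemma cr_in_degree z n (w : n.-tuple rT -> C) : L2fun muR z -> Lambda w ->
  Lambda (wedge (fun1 z) w) /\ cr z (in_degree w) = in_degree (wedge (fun1 z) w).
Proof.
move=> Lz Lw.
have Ew : comp (crf z (extend0 w)) n.+1 = wedge (fun1 z) w.
  by rewrite comp_crf comp_extend0.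
have Lzw : Lambda (wedge (fun1 z) w).
  by rewrite -Ew; apply: Lambda_crf => //; rewrite comp_extend0.
split=> //.
apply: (represents_inj (represents_cr Lz (represents_in_degree Lw))
  (represents_in_degree Lzw)) => k.
have [->|kn] := eqVneq k n.+1; first by rewrite Ew comp_extend0; exact: aeW.
rewrite [X in _ = X %[ae _]]comp_extend0_neq//.
case: k kn => [|k] kn; first by rewrite comp_crf0; exact: aeW.
have e0 : comp (extend0 w) k = comp (fun=> 0 : C) k by rewrite comp_extend0_neq.
apply: aeW => t _; rewrite /comp /crf extE big1 ?mulr0// => i _.
by have := congr1 (fun h => h (deltuple t i)) e0; rewrite /comp => ->; rewrite !mulr0.
Qed.

Lemma cr_creation z : L2fun muR z -> is_creation z (cr z).
Proof. by move=> Lz; split; [exact: cr_bounded|move=> n w; exact: cr_in_degree]. Qed.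

(** Term n on the left equals term n+1 on the right, and term 0 on the right vanishes because a
    created vector has no component in degree 0. *)
Lemma an_adjoint z : L2fun muR z -> is_adjoint (an z) (cr z).
Proof.
move=> Lz x y; have xr := represents_repr x; have yr := represents_repr y.
rewrite (fock_ipE (represents_an Lz xr) yr) (fock_ipE xr (represents_cr Lz yr)).
have E n : fip n (anf z (repr x)) (repr y) = fip n.+1 (repr x) (crf z (repr y)).
  rewrite fipC; [|exact: represents_L2 yr|exact: represents_L2 (represents_an Lz xr)].
  rewrite -fip_adjoint//; [|exact: represents_L2 yr|exact: represents_Lambda xr].
  by rewrite -fipC//; [exact: represents_L2 (represents_cr Lz yr)|exact: represents_L2 xr].
have E0 : fip 0 (repr x) (crf z (repr y)) = 0.
  rewrite /fip comp_crf0 /L2ip; under eq_cintegral do rewrite mulr0.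
  by rewrite cintegral0 mulr0.
rewrite [X in _ = X +i* _]lim_series_shift; last by rewrite E0.
rewrite [X in _ = _ +i* X]lim_series_shift; last by rewrite E0.
by congr (limn (series _) +i* limn (series _)); apply/funext => n; rewrite E.
Qed.

Lemma an_annihilation z : L2fun muR z -> is_annihilation z (an z).
Proof.
move=> Lz; split; first exact: an_bounded.
by exists (cr z); [exact: cr_creation|exact: an_adjoint].
Qed.

(** The test vector is the degree-n component of x - y. Against a vector of one degree the series
    has a single term, so the equality of inner products gives that this component has norm 0. *)
Lemma fock_ip_nondegenerate x y : (forall v, fock_ip x v = fock_ip y v) -> x = y.
Proof.
move=> xy; have xr := represents_repr x; have yr := represents_repr y.
apply: (represents_inj xr yr) => n.
pose w (t : n.-tuple rT) := (-1) * comp (repr y) n t + comp (repr x) n t.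
have Lw : Lambda w by apply: LambdaP; exact: represents_Lambda (represents_repr _).
have wr := represents_in_degree Lw.
have S (v : fock) : fock_ip v (in_degree w) = fip n (repr v) (extend0 w).
  rewrite (fock_ipE (represents_repr v) wr).
  have E0 k : k != n -> fip k (repr v) (extend0 w) = 0.
    move=> kn; rewrite /fip comp_extend0_neq// /L2ip.
    by under eq_cintegral do rewrite mulr0; rewrite cintegral0 mulr0.
  rewrite (@lim_series_single _ _ n)//; last by move=> k /E0 ->.
  rewrite (@lim_series_single _ _ n)//; last by move=> k /E0 ->.
  by apply: complex_ext.
have Lx := represents_L2 n xr; have Ly := represents_L2 n yr.
have : sqnorm (muRn n) w = 0.
  apply: complexI; rewrite -L2ip_sqnorm {1}/w L2ipPl//; last exact: Lw.1.
  have := xy (in_degree w); rewrite !S// /fip comp_extend0.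
  move/(mulfI _) => ->; last by rewrite pnatr_eq0 -lt0n fact_gt0.
  by rewrite -{2}[L2ip _ _ _]mul1r -mulrDl; apply/eqP; rewrite mulf_eq0; apply/orP; left;
    rewrite eq_complex /= !(oppr0, addr0, addNr) eqxx.
move/(sqnorm_eq0 Lw.1); apply: filterS => t w0 _.
by have := w0 I; rewrite /w mulN1r addrC => /eqP; rewrite subr_eq0 => /eqP.
Qed.

Lemma adjoint_unique (A A' B : fock -> fock) :
  is_adjoint A B -> is_adjoint A' B -> A = A'.
Proof.
move=> AB A'B; apply/funext => x; apply: fock_ip_nondegenerate => v.
by rewrite AB A'B.
Qed.

End fock_space.

Opaque cr an fock_ip fock_norm in_degree fock_scale.

(** * Bounded operators, uniqueness and the anticommutation relations on the Fock space *)

Section car.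
Context {R : realType}.
Local Notation rT := (measurableTypeR R).
Local Notation C := R[i].
Local Notation fock := (fock R).
Implicit Types (z w : rT -> C) (f g : seq rT -> C) (x y v : fock).

Lemma bounded_linear (T : fock -> fock) : is_bounded T ->
  [/\ T 0 = 0, {morph T : x / - x}, {morph T : x y / x + y},
      {morph T : x y / x - y} & forall a, {morph T : x / a *: x}].
Proof.
move=> [lT _].
have D : {morph T : x y / x + y} by move=> x y; rewrite -[x]scale1r lT !scale1r.
have T0 : T 0 = 0 by apply: (addIr (T 0)); rewrite -D !add0r.
have Z a : {morph T : x / a *: x}.
  by move=> x; rewrite -[a *: x]addr0 lT T0 addr0.
have N : {morph T : x / - x} by move=> x; rewrite -[- x]scaleN1r Z scaleN1r.
by split=> // x y; rewrite D N.
Qed.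

Lemma representsN x f : represents x f -> represents (- x) (fun s => - f s).
Proof.
move=> xf; have := representsP (-1) xf represents0.
rewrite scaleN1r addr0 (_ : (fun s => _) = fun s => - f s)//.
by apply/funext => s; rewrite mulN1r addr0.
Qed.

Lemma representsZ (a : C) x f : represents x f -> represents (a *: x) (fun s => a * f s).
Proof.
move=> xf; have := representsP a xf represents0.
rewrite addr0 (_ : (fun s => a * f s + 0) = fun s => a * f s)//.
by apply/funext => s; rewrite addr0.
Qed.

Lemma representsD x y f g : represents x f -> represents y g ->
  represents (x + y) (fun s => f s + g s).
Proof.
move=> xf yg; have := representsP 1 xf yg.
rewrite scale1r (_ : (fun s => 1 * f s + g s) = fun s => f s + g s)//.
by apply/funext => s; rewrite mul1r.
Qed.

Lemma bounded_comp (S T : fock -> fock) :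
  is_bounded S -> is_bounded T -> is_bounded (fun x => S (T x)).
Proof.
move=> [lS [M SM]] [lT [N TN]]; split; first by move=> a x y; rewrite lT lS.
exists (`|M| * N) => x; apply: le_trans (SM _) _.
apply: (@le_trans _ _ (`|M| * fock_norm (T x))).
  by apply: ler_wpM2r; [exact: fock_norm_ge0|exact: ler_norm].
by rewrite -mulrA; apply: ler_wpM2l.
Qed.

Lemma bounded_add (S T : fock -> fock) :
  is_bounded S -> is_bounded T -> is_bounded (fun x => S x + T x).
Proof.
move=> [lS [M SM]] [lT [N TN]]; split.
  by move=> a x y; rewrite lS lT scalerDr addrACA.
exists (2 * (M + N)) => x; apply: le_trans (fock_normD _ _) _.
move: (SM x) (TN x); move: (fock_norm _) (fock_norm _) (fock_norm _) => a b c.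
by move=> ? ?; lra.
Qed.

Lemma bounded_scale (a : C) (T : fock -> fock) :
  is_bounded T -> is_bounded (fun x => a *: T x).
Proof.
move=> [lT [M TM]]; split.
  by move=> b x y; rewrite lT scalerDr !scalerA mulrC.
(* The factor 2 is inherited from [fsqP], applied with second summand 0. *)
exists (Num.sqrt (2 * normc a ^+ 2) * M) => x.
rewrite -mulrA; apply: le_trans (ler_wpM2l _ (TM x)); last exact: sqrtr_ge0.
have yr := represents_repr (T x).
apply: (fock_norm_le (representsZ a yr) yr); first by rewrite mulr_ge0 ?sqr_ge0.
apply: total_le => N; apply: (@le_trans _ _ (2 * normc a ^+ 2 *
  \sum_(0 <= n < N) fsq n (repr (T x)))).
  rewrite mulr_sumr; apply: ler_sum => n _.
  have := fsqP a (represents_L2 n yr) (L2fun0 _ : L2fun (muRn n) (comp (fun=> 0) n)).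
  rewrite [fsq n (fun=> 0)]fsq_eq0// mulr0 addr0.
  by congr (fsq n _ <= _); apply/funext => s; rewrite addr0.
by apply: ler_wpM2l; [rewrite mulr_ge0 ?sqr_ge0|apply: series_le_total; case: yr].
Qed.

Definition truncate N x : fock :=
  \sum_(0 <= n < N) in_degree (comp (repr x) n).

Lemma represents_truncate N x :
  represents (truncate N x) (fun s => if (size s < N)%N then repr x s else 0).
Proof.
rewrite /truncate; elim: N => [|N IH].
  rewrite big_geq// (_ : (fun _ => _) = fun=> 0); first exact: represents0.
  by [].
rewrite big_nat_recr//=.
have Lw := represents_Lambda N (represents_repr x).
have := representsD IH (represents_in_degree Lw).
rewrite (_ : (fun s => _ + _) =
  fun s => if (size s < N.+1)%N then repr x s else 0)//; apply/funext => s.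
rewrite ltnS [in RHS]leq_eqVlt; have [sN|sN] := eqVneq (size s) N.
  by rewrite sN ltnn add0r /extend0 insubT ?sN// => e /=.
by rewrite /extend0 insubF ?addr0//; exact: negbTE.
Qed.

(** Density of finite-particle vectors: the squared norm of the tail is the remainder of a
    convergent series. *)
Lemma truncate_cvg x (e : R) : 0 < e -> exists N, fock_norm (x - truncate N x) < e.
Proof.
move=> e0; have xr := represents_repr x; set f := prefock_val (repr x) in xr *.
have [Pf _] := xr; have /prefockP[_ [M fM]] := Pf.
have cf : cvgn (series (fun n => fsq n f)).
  by apply: ge0_series_cvg fM => n; exact: fsq_ge0.
have [N fN] : exists N, total f - \sum_(0 <= n < N) fsq n f < e ^+ 2.
  have /cvgrPdist_lt/(_ _ (exprn_gt0 2 e0)) := cf.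
  move=> [N _ /(_ N (leqnn N))] /= H; exists N.
  by apply: le_lt_trans H; exact: ler_norm.
exists N; have tr := represents_truncate N x.
have dr := representsD xr (representsN tr).
rewrite (fock_normE dr) -[ltRHS](@ger0_norm _ e) ?(ltW e0)// -sqrtr_sqr.
rewrite ltr_sqrt ?exprn_gt0//; apply: le_lt_trans fN.
rewrite lerBrDr.
have E1 n : (n < N)%N -> fsq n (fun s => f s - (if (size s < N)%N then f s else 0)) = 0.
  move=> nN; apply: fsq_eq0; apply/funext => t.
  by rewrite /comp size_tuple nN subrr.
have E2 n : (N <= n)%N -> fsq n (fun s => f s - (if (size s < N)%N then f s else 0)) = fsq n f.
  move=> nN; congr (_ * sqnorm _ _); apply/funext => t.
  by rewrite /comp size_tuple ltnNge nN subr0.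
rewrite -lerBrDr; apply: total_le => K; rewrite lerBrDr.
have [KN|NK] := leqP K N.
  rewrite big_nat big1 ?add0r; first exact: series_le_total.
  by move=> n /andP[_ nK]; apply: E1; exact: leq_trans nK KN.
rewrite (big_cat_nat (n := N))//=; last exact: ltnW.
rewrite big_nat big1 ?add0r; last by move=> n /andP[_ nN]; exact: E1.
rewrite big_nat (eq_bigr (fun n => fsq n f)); last by move=> n /andP[nN _]; exact: E2.
rewrite -big_nat addrC -big_cat_nat//=; last exact: ltnW.
exact: series_le_total.
Qed.

Lemma bounded_eq (S T : fock -> fock) : is_bounded S -> is_bounded T ->
  (forall n (w : n.-tuple rT -> C), Lambda w -> S (in_degree w) = T (in_degree w)) ->
  S = T.
Proof.
move=> bS bT ST; apply/funext => x; apply/eqP; rewrite -subr_eq0; apply/eqP.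
have bD := bounded_add bS (bounded_scale (-1) bT).
have [D0 _ DD DB _] := bounded_linear bD; have [_ [M DM]] := bD.
have tr0 N : S (truncate N x) + -1 *: T (truncate N x) = 0.
  rewrite /truncate; elim: N => [|N IH]; first by rewrite big_geq// D0.
  rewrite big_nat_recr//= DD IH add0r ST; first by rewrite scaleN1r subrr.
  exact: represents_Lambda (represents_repr x).
rewrite -scaleN1r.
apply: fock_norm_eq0; apply/eqP; rewrite eq_le fock_norm_ge0 andbT.
apply/ler_addgt0Pl => e e0; rewrite addr0.
(* The bound [M] may be zero or negative; this replacement can be divided by. *)
have M1 : 0 < `|M| + 1 by rewrite ltr_wpDl.
have [N Ne] := truncate_cvg x (divr_gt0 e0 M1).
have -> : S x + -1 *: T x =
   S (x - truncate N x) + -1 *: T (x - truncate N x).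
  by rewrite DB tr0 subr0.
apply: le_trans (DM _) _.
apply: (@le_trans _ _ ((`|M| + 1) * fock_norm (x - truncate N x))).
  apply: ler_wpM2r; first exact: fock_norm_ge0.
  by apply: le_trans (ler_norm _) _; rewrite lerDl.
by rewrite mulrC -ler_pdivlMr//; exact: ltW.
Qed.

Lemma creation_unique z B : L2fun muR z -> is_creation z B -> B = cr z.
Proof.
move=> Lz [bB Bw]; have [bc cw] := cr_creation Lz.
by apply: bounded_eq => // n w Lw; rewrite (Bw _ _ Lw).2 (cw _ _ Lw).2.
Qed.

Lemma annihilation_unique z A : L2fun muR z -> is_annihilation z A -> A = an z.
Proof.
move=> Lz [_ [B cB AB]]; rewrite (creation_unique Lz cB) in AB.
by apply: (adjoint_unique AB); exact: an_adjoint.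
Qed.

Lemma cr_cr z w x : L2fun muR z -> L2fun muR w -> cr z (cr w x) = - cr w (cr z x).
Proof.
move=> Lz Lw; have xr := represents_repr x.
apply: (represents_inj (represents_cr Lz (represents_cr Lw xr))
  (representsN (represents_cr Lw (represents_cr Lz xr)))) => n.
by apply: aeW => t _; rewrite /comp crf_crf.
Qed.

Lemma an_cr z w x : L2fun muR z -> L2fun muR w ->
  an z (cr w x) + cr w (an z x) = L2ip muR z w *: x.
Proof.
move=> Lz Lw; have xr := represents_repr x.
apply: (represents_inj (representsD (represents_an Lz (represents_cr Lw xr))
  (represents_cr Lw (represents_an Lz xr))) (representsZ _ xr)) => n.
by apply: filterS (anf_crf Lz Lw (represents_L2 n xr)) => u e _; exact: e.
Qed.

(** The sign crosses over inside each term, so linearity of the limits is never invoked. *)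
Lemma fock_ipN x y : fock_ip (- x) y = fock_ip x (- y).
Proof.
have xr := represents_repr x; have yr := represents_repr y.
rewrite (fock_ipE (representsN xr) yr) (fock_ipE xr (representsN yr)).
have E n : fip n (fun s => - repr x s) (repr y) = fip n (repr x) (fun s => - repr y s).
  congr (_ * _); apply: eq_cintegral => t; rewrite /comp.
  rewrite mulrN -mulNr; congr (_ * _).
  by case: (repr x t) => a b; apply: complex_ext.
by congr (limn (series _) +i* limn (series _)); apply/funext => n; rewrite E.
Qed.

Lemma fock_ip_an z x y : L2fun muR z -> fock_ip (an z x) y = fock_ip x (cr z y).
Proof. by move=> Lz; exact: (an_adjoint Lz x y). Qed.

(** The adjoint of [cr_cr]; nondegeneracy of the inner product thus avoids iterated integrals over
    slices. *)
Lemma an_an z w x : L2fun muR z -> L2fun muR w -> an z (an w x) = - an w (an z x).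
Proof.
move=> Lz Lw; apply: fock_ip_nondegenerate => v.
have E1 : fock_ip (an z (an w x)) v = fock_ip x (cr w (cr z v)).
  by rewrite (fock_ip_an (an w x) v Lz) (fock_ip_an x (cr z v) Lw).
have E2 : fock_ip (- an w (an z x)) v = fock_ip x (cr z (cr w (- v))).
  rewrite (fock_ipN (an w (an z x)) v) (fock_ip_an (an z x) (- v) Lw).
  exact: fock_ip_an.
have [_ N1 _ _ _] := bounded_linear (cr_bounded Lz).
have [_ N2 _ _ _] := bounded_linear (cr_bounded Lw).
have E3 : cr w (cr z v) = cr z (cr w (- v)).
  by rewrite (N2 v) (N1 (cr w v)); exact: cr_cr.
exact: (etrans E1 (etrans (congr1 (fock_ip x) E3) (esym E2))).
Qed.

End car.

(** * Clifford operators *)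

Section clifford.
Context {K : comRingType} {V : lmodType K}.

(** The pure products cancel and the mixed ones give e b + e' b. Equal signs yield a Clifford
    relation; opposite signs e' = -e make the two operators anticommute whatever [b] is. *)
Lemma clifford_anticommutator (cz cw az aw : V -> V) (b e e' : K) :
  {morph cz : x y / x + y} -> {morph cw : x y / x + y} ->
  {morph az : x y / x + y} -> {morph aw : x y / x + y} ->
  (forall a, {morph cz : x / a *: x}) -> (forall a, {morph cw : x / a *: x}) ->
  (forall a, {morph az : x / a *: x}) -> (forall a, {morph aw : x / a *: x}) ->
  (forall x, cz (cw x) = - cw (cz x)) -> (forall x, az (aw x) = - aw (az x)) ->
  (forall x, az (cw x) + cw (az x) = b *: x) ->
  (forall x, aw (cz x) + cz (aw x) = b *: x) ->
  forall x, (cz (cw x + e' *: aw x) + e *: az (cw x + e' *: aw x)) +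
    (cw (cz x + e *: az x) + e' *: aw (cz x + e *: az x)) = ((e + e') * b) *: x.
Proof.
move=> czD cwD azD awD czZ cwZ azZ awZ cc aa zw wz x.
have -> : ((e + e') * b) *: x =
    e *: (az (cw x) + cw (az x)) + e' *: (aw (cz x) + cz (aw x)).
  by rewrite zw wz !scalerA -scalerDl mulrDl.
rewrite czD cwD azD awD czZ cwZ azZ awZ cc aa.
rewrite !scalerDr !scalerA !scalerN [e' * e]mulrC.
set A := cw (cz x); set B := (e * e') *: aw (az x).
set S1 := e' *: cz (aw x); set S2 := e *: az (cw x).
set S3 := e *: cw (az x); set S4 := e' *: aw (cz x).
rewrite [- A + S1]addrC -!addrA; rewrite [S4 + B]addrC.
have -> : - A + (S2 + (- B + (A + (S3 + (B + S4))))) = S2 + (S3 + S4).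
  rewrite addrCA; congr (S2 + _); rewrite (addrCA (- B)) addKr.
  by rewrite addrCA; congr (S3 + _); rewrite addKr.
by rewrite addrC -!addrA.
Qed.

(** The inner copies of P0, P1, P2 travel left to their twins past 3, 2 and 1 factors: six sign
    changes, hence no sign overall. *)
Lemma clifford4_sqr (P0 P1 P2 P3 : V -> V) (q0 q1 q2 q3 : K) :
  {morph P0 : x / - x} -> {morph P1 : x / - x} ->
  {morph P2 : x / - x} -> {morph P3 : x / - x} ->
  (forall a, {morph P0 : x / a *: x}) -> (forall a, {morph P1 : x / a *: x}) ->
  (forall a, {morph P2 : x / a *: x}) ->
  (forall x, P0 (P0 x) = q0 *: x) -> (forall x, P1 (P1 x) = q1 *: x) ->
  (forall x, P2 (P2 x) = q2 *: x) -> (forall x, P3 (P3 x) = q3 *: x) ->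
  (forall x, P1 (P0 x) = - P0 (P1 x)) -> (forall x, P2 (P0 x) = - P0 (P2 x)) ->
  (forall x, P3 (P0 x) = - P0 (P3 x)) -> (forall x, P2 (P1 x) = - P1 (P2 x)) ->
  (forall x, P3 (P1 x) = - P1 (P3 x)) -> (forall x, P3 (P2 x) = - P2 (P3 x)) ->
  forall x, P0 (P1 (P2 (P3 (P0 (P1 (P2 (P3 x))))))) = (q0 * q1 * q2 * q3) *: x.
Proof.
move=> N0 N1 N2 N3 Z0 Z1 Z2 S0 S1 S2 S3 A10 A20 A30 A21 A31 A32 x.
rewrite A30 N2 N1 N0 A20 N1 N0 opprK A10 N0 S0.
rewrite A31 N2 N1 A21 N1 opprK S1 A32 N2 S2 S3 !(scalerN, opprK).
by rewrite !scalerA; congr (_ *: _); ring.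
Qed.

(** The four signs cancel; with an odd number of factors the product would anticommute with [Q]. *)
Lemma anticommute4 (Q P0 P1 P2 P3 : V -> V) :
  {morph P0 : x / - x} -> {morph P1 : x / - x} -> {morph P2 : x / - x} ->
  (forall x, Q (P0 x) = - P0 (Q x)) -> (forall x, Q (P1 x) = - P1 (Q x)) ->
  (forall x, Q (P2 x) = - P2 (Q x)) -> (forall x, Q (P3 x) = - P3 (Q x)) ->
  forall x, Q (P0 (P1 (P2 (P3 x)))) = P0 (P1 (P2 (P3 (Q x)))).
Proof.
move=> N0 N1 N2 A0 A1 A2 A3 x.
by rewrite A0 A1 N0 opprK A2 N1 N0 A3 N2 N1 N0 opprK.
Qed.

End clifford.

(** * The operators Psi and Phi, their von Neumann algebra and the vacuum *)

Section chaos.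
Context {R : realType}.
Local Notation rT := (measurableTypeR R).
Local Notation C := R[i].
Local Notation fock := (fock R).
Implicit Types (z w : rT -> C) (x y v : fock).

Lemma L2fun_conjJ z : L2fun muR z -> L2fun muR (conjJ z).
Proof. exact: L2fun_conj. Qed.

(** The integral of z w without conjugation: both b^*(z) and b(Jz) are linear in [z], so the
    Clifford relations involve a bilinear pairing. *)
Definition bilin z w : C := L2ip muR (conjJ z) w.

Lemma bilinC z w : bilin z w = bilin w z.
Proof.
rewrite /bilin /L2ip; apply: eq_cintegral => t.
by rewrite /conjJ !conjcK mulrC.
Qed.

(** Psi(z) for e = 1 and Phi(z) for e = -1. *)
Definition cliff (e : C) z x : fock := cr z x + e *: an (conjJ z) x.

Lemma cliff_bounded e z : L2fun muR z -> is_bounded (cliff e z).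
Proof.
move=> Lz; apply: bounded_add; first exact: cr_bounded.
by apply: bounded_scale; apply: an_bounded; exact: L2fun_conjJ.
Qed.

Lemma cliff_anticommutator e e' z w x : L2fun muR z -> L2fun muR w ->
  cliff e z (cliff e' w x) + cliff e' w (cliff e z x) = ((e + e') * bilin z w) *: x.
Proof.
move=> Lz Lw; have Lz' := L2fun_conjJ Lz; have Lw' := L2fun_conjJ Lw.
have [_ _ D1 _ Z1] := bounded_linear (cr_bounded Lz).
have [_ _ D2 _ Z2] := bounded_linear (cr_bounded Lw).
have [_ _ D3 _ Z3] := bounded_linear (an_bounded Lz').
have [_ _ D4 _ Z4] := bounded_linear (an_bounded Lw').
have cc v : cr z (cr w v) = - cr w (cr z v) by exact: cr_cr.
have aa v : an (conjJ z) (an (conjJ w) v) = - an (conjJ w) (an (conjJ z) v) by exact: an_an.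
have zw v : an (conjJ z) (cr w v) + cr w (an (conjJ z) v) = bilin z w *: v by exact: an_cr.
have wz v : an (conjJ w) (cr z v) + cr z (an (conjJ w) v) = bilin z w *: v.
  by rewrite bilinC; exact: an_cr.
exact: (clifford_anticommutator e e' D1 D2 D3 D4 Z1 Z2 Z3 Z4 cc aa zw wz).
Qed.

Lemma Psi_setP (T : fock -> fock) :
  Psi_set T <-> exists2 z, L2fun muR z & T = cliff 1 z.
Proof.
split=> [[z [B [A [Lz cB aA ->]]]]|[z Lz ->]].
  exists z => //; apply/funext => x; rewrite /cliff scale1r.
  by rewrite (creation_unique Lz cB) (annihilation_unique (L2fun_conjJ Lz) aA).
exists z, (cr z), (an (conjJ z)); split=> //.
- exact: cr_creation.
- exact/an_annihilation/L2fun_conjJ.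
by apply/funext => x; rewrite /cliff scale1r.
Qed.

Lemma bounded_cliff4 e z0 z1 z2 z3 :
  L2fun muR z0 -> L2fun muR z1 -> L2fun muR z2 -> L2fun muR z3 ->
  is_bounded (fun x => cliff e z0 (cliff e z1 (cliff e z2 (cliff e z3 x)))).
Proof.
move=> L0 L1 L2 L3.
have b3 := cliff_bounded e L3.
have b2 := bounded_comp (cliff_bounded e L2) b3.
have b1 := bounded_comp (cliff_bounded e L1) b2.
exact: bounded_comp (cliff_bounded e L0) b1.
Qed.

(* [cliff (-1) z] anticommutes with every Psi(w): it acts, up to the parity
   of the degree, as multiplication by z on the right. *)
Lemma cliff_commutant z0 z1 z2 z3 :
  L2fun muR z0 -> L2fun muR z1 -> L2fun muR z2 -> L2fun muR z3 ->
  commutant Psi_set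
    (fun x => cliff (-1) z0 (cliff (-1) z1 (cliff (-1) z2 (cliff (-1) z3 x)))).
Proof.
move=> L0 L1 L2 L3; split; first exact: bounded_cliff4.
move=> A /Psi_setP[z Lz ->]; apply/funext => x /=.
have [_ N0 _ _ _] := bounded_linear (cliff_bounded (-1) L0).
have [_ N1 _ _ _] := bounded_linear (cliff_bounded (-1) L1).
have [_ N2 _ _ _] := bounded_linear (cliff_bounded (-1) L2).
have AC w : L2fun muR w -> forall v, cliff 1 z (cliff (-1) w v) = - cliff (-1) w (cliff 1 z v).
  move=> Lw v; apply/eqP; rewrite -addr_eq0; apply/eqP.
  apply: etrans (cliff_anticommutator 1 (-1) v Lz Lw) _.
  by rewrite subrr mul0r scale0r.
by rewrite (anticommute4 N0 N1 N2 (AC _ L0) (AC _ L1) (AC _ L2) (AC _ L3)).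
Qed.

Lemma cliff_bicommutant z0 z1 z2 z3 :
  L2fun muR z0 -> L2fun muR z1 -> L2fun muR z2 -> L2fun muR z3 ->
  CliffordvN (fun x => cliff 1 z0 (cliff 1 z1 (cliff 1 z2 (cliff 1 z3 x)))).
Proof.
move=> L0 L1 L2 L3; split; first exact: bounded_cliff4.
move=> A [_ cA]; apply/funext => x /=.
have c z v : L2fun muR z -> cliff 1 z (A v) = A (cliff 1 z v).
  move=> Lz; have PT : Psi_set (cliff 1 z) by apply/Psi_setP; exists z.
  exact: esym (congr1 (fun h => h v) (cA _ PT)).
by rewrite (c z3 _ L3) (c z2 _ L2) (c z1 _ L1) (c z0 _ L0).
Qed.

(** Half of the anticommutator of the operator with itself. *)
Lemma cliff_sqr z x : L2fun muR z -> cliff (-1) z (cliff (-1) z x) = (- bilin z z) *: x.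
Proof.
move=> Lz; have := cliff_anticommutator (-1) (-1) x Lz Lz.
set v := cliff _ _ _ => E.
have E2 : (2 : C) *: v = (2 : C) *: ((- bilin z z) *: x).
  rewrite scalerA -[LHS]addr0 (_ : 2 * - bilin z z = (-1 + -1) * bilin z z); last by ring.
  by rewrite -E addr0 -[v in RHS]scale1r -scalerDl.
have := congr1 (fun u => (2 : C)^-1 *: u) E2.
have n2 : (2 : C) != 0 by rewrite pnatr_eq0.
by rewrite (scalerA _ 2 v) (scalerA _ 2 (_ *: x)) mulVf// !scale1r.
Qed.

Lemma cliff_anticommute z w x : L2fun muR z -> L2fun muR w -> bilin z w = 0 ->
  cliff (-1) z (cliff (-1) w x) = - cliff (-1) w (cliff (-1) z x).
Proof.
move=> Lz Lw zw; apply/eqP; rewrite -addr_eq0; apply/eqP.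
apply: etrans (cliff_anticommutator (-1) (-1) x Lz Lw) _.
by rewrite zw mulr0 scale0r.
Qed.

Lemma an_vacuum z : L2fun muR z -> an z (@vacuum R) = 0.
Proof.
move=> Lz; have vr := represents_in_degree (@Lambda_vacuum R).
apply: (represents_inj (represents_an Lz vr) represents0) => n.
apply: aeW => t _; rewrite /comp anf_tuple /L2ip.
have E s : extend0 (fun _ : 0.-tuple rT => 1 : C) (s :: t) = 0.
  by rewrite /extend0 insubF.
by under eq_cintegral do rewrite E mulr0; rewrite cintegral0 mulr0.
Qed.

(** Makes the annihilation parts drop out when a product of [cliff] operators with orthogonal
    arguments is applied to the vacuum. *)
Lemma an_cr_orth z w x : L2fun muR z -> L2fun muR w -> L2ip muR z w = 0 ->
  an z x = 0 -> an z (cr w x) = 0.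
Proof.
move=> Lz Lw zw zx; have := an_cr x Lz Lw.
have [c0 _ _ _ _] := bounded_linear (cr_bounded Lw).
by rewrite zx c0 addr0 zw scale0r.
Qed.

Lemma cliff_cr e z x : an (conjJ z) x = 0 -> cliff e z x = cr z x.
Proof. by move=> zx; rewrite /cliff zx scaler0 addr0. Qed.

Lemma bigwedge0 (f : 'I_0 -> rT -> C) : bigwedge f = fun=> 1.
Proof. by apply/funext => t; rewrite bigwedgeE det_mx00 mulr1 invr1. Qed.

Lemma cr_bigwedge n (f : 'I_n.+1 -> rT -> C) : L2fun muR (f ord0) ->
  Lambda (bigwedge (fun i => f (lift ord0 i))) ->
  Lambda (bigwedge f) /\
  cr (f ord0) (in_degree (bigwedge (fun i => f (lift ord0 i)))) = in_degree (bigwedge f).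
Proof.
move=> L0 Lw; have E : bigwedge f = wedge (fun1 (f ord0)) (bigwedge (fun i => f (lift ord0 i))).
  apply/funext => t; rewrite bigwedge_recl.
  by rewrite (@wedge_fun1 R n (f ord0))//; exact: Lw.2.
have := cr_in_degree L0 Lw.
by rewrite -[wedge _ _]E.
Qed.

End chaos.

(** * The contraction *)

Transparent muRn.

Section contraction.
Context {R : realType}.
Local Notation rT := (measurableTypeR R).
Local Notation C := R[i].

Lemma cintegral_muR0 (F : 0.-tuple rT -> C) : cintegral (muRn 0) F = F [tuple].
Proof.
have -> : F = fun=> F [tuple] by apply/funext => t; rewrite (tuple0 t).
have m1 : muRn 0 [set: 0.-tuple rT] = 1%E by exact: diracT.
apply: complex_ext; rewrite /= Rintegral_cst// -[RHS]mulr1; congr (_ * _);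
  exact: (congr1 fine m1).
Qed.

Lemma L2fun_muRn1 (h : rT -> C) : L2fun muR h ->
  L2fun (muRn 1) (fun u : 1.-tuple rT => h u`_0).
Proof.
move=> Lh; have := L2fun_ctensor Lh (@Lambda_vacuum R).1.
by congr L2fun; apply/funext => u; rewrite /ctensor mulr1 (tuple_cons u) theadE.
Qed.

Lemma L2fun_muRn2 (h k : rT -> C) : L2fun muR h -> L2fun muR k ->
  L2fun (muRn 2) (fun u : 2.-tuple rT => h u`_0 * k u`_1).
Proof.
move=> Lh Lk; have := L2fun_ctensor Lh (L2fun_muRn1 Lk).
by congr L2fun; apply/funext => u; rewrite /ctensor (tuple_cons u) theadE behead_cons.
Qed.

Lemma integrableC_muRn1 (p q : rT -> C) : L2fun muR p -> L2fun muR q ->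
  integrableC (muRn 1) (fun u : 1.-tuple rT => p u`_0 * q u`_0).
Proof.
by move=> Lp Lq; apply: L2funM; exact: L2fun_muRn1.
Qed.

Lemma cintegral_muRn1 (p q : rT -> C) : L2fun muR p -> L2fun muR q ->
  cintegral (muRn 1) (fun u : 1.-tuple rT => p u`_0 * q u`_0) =
  cintegral muR (fun s => p s * q s).
Proof.
move=> Lp Lq; rewrite cintegral_cons; last exact: integrableC_muRn1.
by apply: eq_cintegral => s; rewrite cintegral_muR0.
Qed.

Lemma cintegral_muRn2 (p q r s : rT -> C) :
  L2fun muR p -> L2fun muR q -> L2fun muR r -> L2fun muR s ->
  cintegral (muRn 2) (fun u : 2.-tuple rT => (p u`_0 * q u`_0) * (r u`_1 * s u`_1)) =
  cintegral muR (fun t => p t * q t) * cintegral muR (fun t => r t * s t).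
Proof.
move=> Lp Lq Lr Ls.
rewrite cintegral_cons; last first.
  have := L2funM (L2fun_muRn2 Lp Lr) (L2fun_muRn2 Lq Ls).
  by congr integrableC; apply/funext => u; rewrite mulrACA.
rewrite mulrC -cintegralZ; last exact: L2funM.
apply: eq_cintegral => a.
rewrite -[RHS]mulrC -(cintegral_muRn1 Lr Ls) -cintegralZ; last exact: integrableC_muRn1.
exact: eq_cintegral.
Qed.

Lemma bigwedge_repeat n (f : 'I_n -> rT -> C) i j : i != j -> f i = f j ->
  bigwedge f = fun=> 0.
Proof.
move=> ij fij; apply/funext => t; rewrite bigwedgeE (determinant_alternate ij) ?mulr0//.
by move=> k; rewrite !mxE fij.
Qed.

(** The transposed determinant: permutations act on the functions and not on the variables, so that
    in the contraction each integrated variable carries one definite function of each factor. *)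
Lemma bigwedge_trE n (f : 'I_n -> rT -> C) t :
  bigwedge f t = (n`!%:R)^-1 * \sum_(s : 'S_n) (-1) ^+ s * \prod_i f (s i) (tnth t i).
Proof.
rewrite bigwedgeE -det_tr; congr (_ * _); apply: eq_bigr => s _; congr (_ * _).
by apply: eq_bigr => i _; rewrite !mxE.
Qed.

Variable f : 'I_4 -> rT -> C.
Hypothesis f_L2 : forall i, L2fun muR (f i).
Hypothesis f_real : forall i, {ae muR, forall t, complex.Im (f i t) = 0}.
Hypothesis f_orth : forall i j, i != j -> L2ip muR (f i) (f j) = 0.

Let i1 : 'I_4 := lift ord0 ord0.
Let i2 : 'I_4 := lift ord0 (lift ord0 ord0).
Let i3 : 'I_4 := lift ord0 (lift ord0 (lift ord0 ord0)).

(* The arguments of f wedge_2 f carry the first two functions of one factor and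
   the last two of the other. *)
Definition splice (s r : 'S_4) (i : 'I_4) : 'I_4 := if (i < 2)%N then s i else r i.

Lemma real_conj (h : rT -> C) : {ae muR, forall t, complex.Im (h t) = 0} ->
  (fun t => conjc (h t)) = h %[ae muR].
Proof.
apply: filterS => t ht _; apply: complex_ext; first by rewrite complex_Re_conj.
by rewrite complex_Im_conj ht oppr0.
Qed.

(** The contraction contains no conjugate; since [f i] is real almost everywhere, its integrals are
    inner products all the same. *)
Lemma cintegral_orth i j : i != j -> cintegral muR (fun t => f i t * f j t) = 0.
Proof.
move=> ij; rewrite -(f_orth ij); apply: ae_cintegral.
- by apply: measurableCM; exact: L2fun_measurable.
- by apply: measurableCM; [apply: measurableC_conj|]; exact: L2fun_measurable.
by apply: filterS (real_conj (f_real i)) => t e _; rewrite e.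
Qed.

(** The integrated variables enter the first factor in reverse order, so position 3 of [s] meets
    position 0 of [r], and position 2 meets position 1. *)
Definition contraction_coef (s r : 'S_4) : C :=
  (4`!%:R)^-1 ^+ 2 * (-1) ^+ s * (-1) ^+ r *
    (cintegral muR (fun t => f (s i3) t * f (r ord0) t) *
     cintegral muR (fun t => f (s i2) t * f (r i1) t)).

Lemma contraction_rearrange (K : comRingType) (k e e' a0 a1 a2 a3 b0 b1 b2 b3 : K) :
  k * ((e * (a0 * (a1 * (a2 * (a3 * 1))))) * (e' * (b0 * (b1 * (b2 * (b3 * 1)))))) =
  k * e * e' * (a0 * (a1 * (b2 * (b3 * 1)))) * (a3 * b0 * (a2 * b1)).
Proof. by ring. Qed.

Lemma contract2_bigwedge t : contract2 (bigwedge f) (bigwedge f) t =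
  \sum_(s : 'S_4) \sum_(r : 'S_4) contraction_coef s r *
    \prod_(i < 4) f (splice s r i) (tnth t i).
Proof.
pose G (s r : 'S_4) (u : 2.-tuple rT) :=
  (f (s i3) u`_0 * f (r ord0) u`_0) * (f (s i2) u`_1 * f (r i1) u`_1).
pose c (s r : 'S_4) : C := (4`!%:R)^-1 ^+ 2 * (-1) ^+ s * (-1) ^+ r *
   \prod_(i < 4) f (splice s r i) (tnth t i).
have IG s r : integrableC (muRn 2) (G s r).
  have := L2funM (L2fun_muRn2 (f_L2 (s i3)) (f_L2 (s i2)))
    (L2fun_muRn2 (f_L2 (r ord0)) (f_L2 (r i1))).
  by congr integrableC; apply/funext => u; rewrite /G mulrACA.
rewrite /contract2.
transitivity (cintegral (muRn 2) (fun u => \sum_(s : 'S_4) \sum_(r : 'S_4) c s r * G s r u)).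
  apply: eq_cintegral => u; rewrite !bigwedge_trE mulrACA -expr2 mulr_suml mulr_sumr.
  apply: eq_bigr => s _; rewrite !mulr_sumr; apply: eq_bigr => r _.
  rewrite /c /G !big_ord_recl !big_ord0 /splice !(tnth_nth 0) /= -/i1 -/i2 -/i3.
  exact: contraction_rearrange.
rewrite cintegral_sum; last first.
  by move=> s _; apply: integrableC_sum => r _; exact: integrableCZ.
apply: eq_bigr => s _; rewrite cintegral_sum; last by move=> r _; exact: integrableCZ.
apply: eq_bigr => r _; rewrite cintegralZ// cintegral_muRn2// /c /contraction_coef.
by rewrite mulrAC.
Qed.

(** If neither integral vanishes, the last two functions of [s] are the first two of [r]. The first
    two of [s] and the last two of [r] are then the same complementary pair, so the splice repeats a
    function: [j] is the place among the first two where [r i2] recurs. *)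
Lemma contraction_vanishes s r :
  contraction_coef s r = 0 \/ bigwedge (fun i => f (splice s r i)) = fun=> 0.
Proof.
have [e30|ne] := eqVneq (s i3) (r ord0); last first.
  by left; rewrite /contraction_coef (cintegral_orth ne) mul0r mulr0.
have [e21|ne] := eqVneq (s i2) (r i1); last first.
  by left; rewrite /contraction_coef (cintegral_orth ne) !mulr0.
right; pose j := (s^-1)%g (r i2).
have sj : s j = r i2 by rewrite permKV.
have ji2 : j != i2.
  by apply/eqP => ji; move: sj; rewrite ji e21 => /perm_inj.
have ji3 : j != i3.
  by apply/eqP => ji; move: sj; rewrite ji e30 => /perm_inj.
have j2 : (j < 2)%N.
  move: ji2 ji3; rewrite -!val_eqE /=; by case: (j) => -[|[|[|[|]]]] //=.
apply: (@bigwedge_repeat _ _ j i2) => //.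
by rewrite /splice j2 /= sj.
Qed.

Lemma antisym_contract2 : antisym (contract2 (bigwedge f) (bigwedge f)) = fun=> 0.
Proof.
apply/funext => t; rewrite /antisym.
under eq_bigr do rewrite contract2_bigwedge mulr_sumr.
rewrite exchange_big /= big1 ?mulr0// => s _.
under eq_bigr do rewrite mulr_sumr.
rewrite exchange_big /= big1// => r _.
have [c0|/(congr1 (fun h => h t))] := contraction_vanishes s r.
  by rewrite big1// => q _; rewrite c0 mul0r mulr0.
(* The prefactor 1/4! is nonzero, so the signed sum itself vanishes. *)
rewrite /bigwedge /antisym => /eqP; rewrite mulf_eq0 invr_eq0 pnatr_eq0 /= => /eqP w0.
under eq_bigr do rewrite mulrCA.
by rewrite -mulr_sumr w0 mulr0.
Qed.

End contraction.

(** * The theorem *)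

Opaque cliff.

Section vacuum_expectation.
Context {R : realType}.
Local Notation rT := (measurableTypeR R).
Local Notation C := R[i].
Local Notation fock := (fock R).

Lemma trace_scalar (u : fock -> fock) (c : C) :
  u (@vacuum R) = c *: @vacuum R -> trace_m u = c.
Proof.
move=> uc; rewrite /trace_m uc.
have vr := represents_in_degree (@Lambda_vacuum R).
rewrite (fock_ipE vr (representsZ c vr)).
have E n : n != 0%N -> fip n (extend0 (fun _ : 0.-tuple rT => 1 : C))
    (fun s => c * extend0 (fun _ : 0.-tuple rT => 1) s) = 0.
  move=> n0; rewrite /fip comp_extend0_neq// /L2ip.
  under eq_cintegral do rewrite conjc0 mul0r.
  by rewrite cintegral0 mulr0.
have E0 : fip 0 (extend0 (fun _ : 0.-tuple rT => 1 : C))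
    (fun s => c * extend0 (fun _ : 0.-tuple rT => 1) s) = c.
  rewrite /fip mul1r /L2ip cintegral_muR0 comp_extend0 conjc1 mul1r.
  by rewrite /comp /extend0 insubT//= mulr1.
rewrite (@lim_series_single _ _ 0); last by move=> n /E ->.
rewrite (@lim_series_single _ _ 0); last by move=> n /E ->.
by rewrite E0; apply: complex_ext.
Qed.

Variable f : 'I_4 -> rT -> C.
Hypothesis f_L2 : forall i, L2fun muR (f i).
Hypothesis f_real : forall i, {ae muR, forall t, complex.Im (f i t) = 0}.
Hypothesis f_orth : forall i j, i != j -> L2ip muR (f i) (f j) = 0.

Let i1 : 'I_4 := lift ord0 ord0.
Let i2 : 'I_4 := lift ord0 (lift ord0 ord0).
Let i3 : 'I_4 := lift ord0 (lift ord0 (lift ord0 ord0)).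

Lemma bilin_real i j : bilin (f i) (f j) = L2ip muR (f i) (f j).
Proof.
apply: ae_L2ip => //; [exact/L2fun_conjJ|exact: real_conj|exact: aeW].
Qed.

(** Orthogonality suppresses every annihilation part, so the value does not depend on [e]. This is
    why an operator of the algebra (e = 1) and one of its commutant (e = -1) agree at the vacuum. *)
Lemma cliff4_vacuum e : Lambda (bigwedge f) /\
  cliff e (f ord0) (cliff e (f i1) (cliff e (f i2) (cliff e (f i3) (@vacuum R)))) =
  in_degree (bigwedge f).
Proof.
have Lv : Lambda (bigwedge (fun i : 'I_0 =>
    f (lift ord0 (lift ord0 (lift ord0 (lift ord0 i)))))).
  by rewrite bigwedge0; exact: Lambda_vacuum.
have [L3 E3] := cr_bigwedge (f_L2 i3 : L2fun muR ((fun i : 'I_1 =>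
    f (lift ord0 (lift ord0 (lift ord0 i)))) ord0)) Lv.
have [L2 E2] := cr_bigwedge (f_L2 i2 : L2fun muR ((fun i : 'I_2 =>
    f (lift ord0 (lift ord0 i))) ord0)) L3.
have [L1 E1] := cr_bigwedge (f_L2 i1 : L2fun muR ((fun i : 'I_3 =>
    f (lift ord0 i)) ord0)) L2.
have [L0 E0] := cr_bigwedge (f_L2 ord0) L1.
split=> //.
have an0 i : an (conjJ (f i)) (@vacuum R) = 0 by apply/an_vacuum/L2fun_conjJ.
have anC i j x : i != j -> an (conjJ (f i)) x = 0 -> an (conjJ (f i)) (cr (f j) x) = 0.
  move=> ij; apply: an_cr_orth => //; first exact: L2fun_conjJ.
  by rewrite -/(bilin _ _) bilin_real f_orth.
rewrite (cliff_cr e (an0 i3)).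
rewrite (cliff_cr e (anC i2 i3 _ isT (an0 i2))).
rewrite (cliff_cr e (anC i1 i2 _ isT (anC i1 i3 _ isT (an0 i1)))).
rewrite (cliff_cr e (anC ord0 i1 _ isT (anC ord0 i2 _ isT (anC ord0 i3 _ isT (an0 ord0))))).
rewrite -E0 -E1 -E2 -E3; congr (cr _ (cr _ (cr _ (cr _ _)))).
by rewrite bigwedge0.
Qed.

Lemma chaos_exists : exists F : fock -> fock, is_chaos (bigwedge f) F.
Proof.
have [Lg E] := cliff4_vacuum 1.
exists (fun x => cliff 1 (f ord0) (cliff 1 (f i1) (cliff 1 (f i2) (cliff 1 (f i3) x)))).
by split=> //; exact: cliff_bicommutant.
Qed.

Definition sqnorm_prod : R := sqnorm muR (f ord0) * sqnorm muR (f i1) *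
  sqnorm muR (f i2) * sqnorm muR (f i3).

(* F and the operator [T] below, which lies in the commutant, have the same
   value at the vacuum, so that F^k vacuum = T^k vacuum. *)
Lemma chaos_sqr_vacuum (F : fock -> fock) : is_chaos (bigwedge f) F ->
  F (F (@vacuum R)) = sqnorm_prod%:C *: @vacuum R.
Proof.
move=> [_ [_ cF] Fv].
pose T x := cliff (-1) (f ord0) (cliff (-1) (f i1) (cliff (-1) (f i2) (cliff (-1) (f i3) x))).
have cT : commutant Psi_set T by exact: cliff_commutant.
have FT x : F (T x) = T (F x) by exact: (congr1 (fun h => h x) (cF _ cT)).
have FTv : F (@vacuum R) = T (@vacuum R) by rewrite Fv /T (cliff4_vacuum (-1)).2.
have -> : F (F (@vacuum R)) = T (T (@vacuum R)).
  exact: (etrans (congr1 F FTv) (etrans (FT (@vacuum R)) (congr1 T FTv))).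
have B i : is_bounded (cliff (-1) (f i)) by exact: cliff_bounded.
have N i : {morph cliff (-1) (f i) : x / - x} by have [_ ? _ _ _] := bounded_linear (B i).
have Z i a : {morph cliff (-1) (f i) : x / a *: x}.
  by have [_ _ _ _ ?] := bounded_linear (B i).
have S i x : cliff (-1) (f i) (cliff (-1) (f i) x) = (- (sqnorm muR (f i))%:C) *: x.
  by rewrite -L2ip_sqnorm -bilin_real; exact: cliff_sqr.
have A i j : i != j -> forall x,
    cliff (-1) (f i) (cliff (-1) (f j) x) = - cliff (-1) (f j) (cliff (-1) (f i) x).
  by move=> ij x; apply: cliff_anticommute => //; rewrite bilin_real f_orth.
have := clifford4_sqr (N ord0) (N i1) (N i2) (N i3) (Z ord0) (Z i1) (Z i2)
  (S ord0) (S i1) (S i2) (S i3) (A i1 ord0 isT) (A i2 ord0 isT) (A i3 ord0 isT)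
  (A i2 i1 isT) (A i3 i1 isT) (A i3 i2 isT) (@vacuum R).
move=> E; apply: etrans E _; congr (_ *: _).
by rewrite /sqnorm_prod !rmorphM /= !(mulrN, mulNr, opprK).
Qed.

Hypothesis f_neq0 : forall i, ~ (f i = (fun=> 0) %[ae muR]).

Lemma sqnorm_prod_gt0 : 0 < sqnorm_prod.
Proof.
have P i : 0 < sqnorm muR (f i).
  rewrite lt_neqAle sqnorm_ge0 andbT eq_sym; apply/eqP => s0.
  by apply: (@f_neq0 i); exact: sqnorm_eq0.
by rewrite /sqnorm_prod !mulr_gt0.
Qed.

Lemma K_fun_neq0 (F : fock -> fock) : is_chaos (bigwedge f) F -> K_fun (bigwedge f) F != 0.
Proof.
move=> cF; have E := chaos_sqr_vacuum cF.
have [_ _ _ _ FZ] := bounded_linear (let: And3 _ vF _ := cF in vF.1).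
set n := sqnorm_prod in E.
have t2 : trace_m (iter 2 F) = n%:C by exact: trace_scalar.
have t4 : trace_m (iter 4 F) = (n ^+ 2)%:C.
  (* Linearity of [F] carries the scalar from [F (F vacuum)] through two further applications. *)
  apply: trace_scalar; rewrite [iter 4 F _]/= E FZ FZ E scalerA.
  by rewrite -rmorphM /= expr2.
rewrite /K_fun t2 t4; move: (2 * 4)`!%N => m.
set X := fine _.
(* An infinite integral would be sent to 0 by [fine], so nonnegativity holds in either case. *)
have X0 : 0 <= X.
  apply: fine_ge0; apply: integral_ge0 => t _; rewrite L2norm_sqr.
  by apply: integral_ge0 => s _; exact: normc2_ge0.
have n0 : 0 < n by exact: sqnorm_prod_gt0.
have -> : (n ^+ 2)%:C - 2 * n%:C ^+ 2 - (-1) ^+ 4 / 2 * m%:R * X%:C =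
    - (n ^+ 2 + m%:R / 2 * X)%:C :> C.
  rewrite -signr_odd expr0 rmorphD !rmorphM fmorphV /= !rmorph_nat.
  by field.
rewrite oppr_eq0 eq_complex /= eqxx andbT gt_eqF//.
by apply: ltr_wpDr; [rewrite !mulr_ge0|rewrite exprn_gt0].
Qed.

End vacuum_expectation.

Theorem theorem4p27 (R : realType) (f : 'I_4 -> measurableTypeR R -> R[i])
    (f_L2 : forall i, L2fun muR (f i))
    (f_real : forall i, {ae muR, forall t, complex.Im (f i t) = 0})
    (f_neq0 : forall i, ~ (f i = (fun=> 0) %[ae muR]))
    (f_orth : forall i j, i != j -> L2ip muR (f i) (f j) = 0) :
  let g : 4.-tuple (measurableTypeR R) -> R[i] := bigwedge f in
  [/\ exists F : fock R -> fock R, is_chaos g F,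
      forall F : fock R -> fock R, is_chaos g F -> K_fun g F != 0
    & L2norm (muRn 4) (antisym (contract2 g g)) = 0%E].
Proof.
move=> g; split; first exact: chaos_exists.
  by move=> F; exact: K_fun_neq0.
rewrite /g antisym_contract2// /L2norm.
under eq_Lnorm do rewrite ComplexField.Normc.normc0.
exact: Lnorm0.
Qed.
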